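(* Let $\mathcal G$ be the lozenge graph: its vertices are $N$, $F$, $P_2$, $P_5$, and it has five edges numbered $1,\dots,5$, where edge $1$ joins $N$ and $P_2$, edge $2$ joins $P_2$ and $F$, edge $3$ joins $P_2$ and $P_5$, edge $4$ joins $N$ and $P_5$, and edge $5$ joins $P_5$ and $F$. Let $W_i(n)$ denote the weight of edge $i$ at time $n$ in the trace-reinforced ant process on $\mathcal G$, and $\mathbf W(n)=(W_i(n))_{1\le i\le5}$. Then almost surely as $n\to+\infty$, \[\frac{\mathbf W(n)}{n}\to\left(w^*,\tfrac12,\tfrac12,w^*,\tfrac12\right),\] where $w^*$ is the unique solution of $2x^3+4x^2-2x-\tfrac32=0$ in $(0,1)$.
   Context: Trace-reinforced ant process. Let $\mathcal G=(V,E)$ be a finite undirected graph with two distinct marked nodes $N$ (nest) and $F$ (food). Random weights $\mathbf W(n)=(W_e(n))_{e\in E}$, $n\ge 0$, are defined recursively. At time $0$, $W_e(0)=1$ for all $e\in E$. Given $\mathbf W(n)$ (and independently of the rest of the past), run a random walk on $\mathcal G$ started at $N$ and stopped when it first hits $F$; at each step, from a vertex $u\ne F$, it crosses an edge $e$ incident to $u$ with probability $W_e(n)/\sum_{e'\sim u}W_{e'}(n)$, where the sum is over the edges $e'$ incident to $u$ (the weights being kept fixed equal to $\mathbf W(n)$ during the whole walk). Let $\gamma(n+1)$ be the set of edges crossed at least once by this walk, and set $W_e(n+1)=W_e(n)+\mathbf 1_{e\in\gamma(n+1)}$ for all $e\in E$. *)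

(* Defs.v *)
From HB Require Import structures.
From mathcomp Require Import all_boot all_order all_algebra.
From mathcomp Require Import all_classical all_reals all_analysis.

Set Implicit Arguments.
Unset Strict Implicit.
Unset Printing Implicit Defensive.

Import Order.TTheory GRing.Theory Num.Theory.
Import numFieldNormedType.Exports.

Local Open Scope classical_set_scope.
Local Open Scope ring_scope.

(* The pair [ends e] is unordered: incidence and crossing treat its two
   components symmetrically. *)
Record ant_graph := AntGraph {
  vertex : finType;
  edge : finType;
  ends : edge -> vertex * vertex;
  nest : vertex;
  food : vertex;
  nest_neq_food : nest != food
}.

Section Walk.
Variable G : ant_graph.

Definition incident (e : edge G) (u : vertex G) : bool :=
  (u == (ends e).1) || (u == (ends e).2).

Definition other_end (e : edge G) (u : vertex G) : vertex G :=
  if u == (ends e).1 then (ends e).2 else (ends e).1.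

(* A step of a walk is [Some e] when edge [e] is crossed, and [None] when the
   walk has already been stopped. *)
Definition move (u : vertex G) (o : option (edge G)) : vertex G :=
  if o is Some e then other_end e u else u.

Definition position (s : seq (option (edge G))) : vertex G :=
  foldl move (nest G) s.

Definition step_prob (R : realType) (w : {ffun edge G -> nat}) (u : vertex G)
    (o : option (edge G)) : R :=
  match o with
  | Some e => if (u != food G) && incident e u
              then (w e)%:R / \sum_(e' : edge G | incident e' u) (w e')%:R
              else 0
  | None => (u == food G)%:R
  end.

End Walk.

Section Process.
Variables (G : ant_graph) (T : Type).
(* [walk n k t] is the [k]-th step (from 0) of the walk run with the weights at
   time [n], whose trace is therefore gamma(n+1). *)
Variable walk : nat -> nat -> T -> option (edge G).

Definition trace (n : nat) (t : T) : {set edge G} :=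
  [set e | `[< exists k, walk n k t = Some e >]]%SET.

Fixpoint weight (n : nat) (t : T) : {ffun edge G -> nat} :=
  if n is m.+1 then [ffun e => (weight m t e + (e \in trace m t))%N]
  else [ffun=> 1%N].

Definition past (n : nat) : set_system T :=
  <<s [set B | exists m k o, (m < n)%N /\ B = [set t | walk m k t = o]] >>.

Definition starts_with (n : nat) (s : seq (option (edge G))) : set T :=
  [set t | mkseq (fun k => walk n k t) (size s) = s].

End Process.

(* Since the weights at time [n] and finite prefixes of a walk are discrete, the
   conditional law of the next step is expressed by elementary conditioning on
   their values, jointly with an arbitrary event of the past. *)
Record trace_reinforced_ants (G : ant_graph) (d : measure_display)
    (T : measurableType d) (R : realType) (P : probability T R)
    (walk : nat -> nat -> T -> option (edge G)) : Prop := TraceReinforcedAnts {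
  measurable_walk : forall n k o, measurable [set t | walk n k t = o];
  walk_step : forall (n : nat) (A : set T) (w : {ffun edge G -> nat})
      (s : seq (option (edge G))) (o : option (edge G)),
    past walk n A ->
    let H := A `&` [set t | weight walk n t = w] `&` starts_with walk n s in
    (P (H `&` [set t | walk n (size s) t = o]) =
     P H * (step_prob R w (position s) o)%:E)%E
}.

Definition lozN : 'I_4 := @Ordinal 4 0 isT.
Definition lozF : 'I_4 := @Ordinal 4 1 isT.
Definition lozP2 : 'I_4 := @Ordinal 4 2 isT.
Definition lozP5 : 'I_4 := @Ordinal 4 3 isT.

(* Ordinal [i] stands for the edge numbered [i + 1]. *)
Definition lozenge_ends (i : 'I_5) : 'I_4 * 'I_4 :=
  tnth [tuple (lozN, lozP2); (lozP2, lozF); (lozP2, lozP5);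
              (lozN, lozP5); (lozP5, lozF)] i.

Definition lozenge : ant_graph :=
  @AntGraph 'I_4 'I_5 lozenge_ends lozN lozF isT.

(* Main.v *)
(* First-step analysis gives the probability [w_e * rate_e (w)] that a walk with
   weights [w] crosses the edge [e]. The increments of
   [sum_k (1_{e in gamma(k+1)} - w_e rate_e) / W_e(k)] are martingale differences
   whose conditional second moments are at most the conditional expectations of the
   decrements of [2 / W_e], so this sum converges almost surely. Since [ln W_e]
   differs from [sum_k 1_{e in gamma(k+1)} / W_e(k)] by a convergent sequence, each
   logarithm [ln (W_e(n) / (n + 2))] is, up to a convergent sequence, driven by the drift
   [(rate_e - 1) / (n + 2)] evaluated at the normalized weights [x_e]: whenever this
   drift keeps a sign beyond a level, the level is eventually respected. Working
   with logarithms makes the noise summable even near the boundary, so that no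
   separate argument is needed to exclude unstable equilibria.

   Exactly one of the edges 2, 5 and at least one of the edges 1, 4 is crossed, so
   [x_2 + x_5 = 1] and [x_1 + x_4 >= 1]. Successively: [x_1] and [x_4] stay away
   from 0; hence so do [x_2] and [x_5]; with [alpha = x_1 / (x_1 + x_4)], [x_2] is
   attracted by [alpha], while [alpha] is attracted by 1/2 as soon as
   [|x_2 - 1/2| <= (1 + 1/20) |alpha - 1/2|], and iterating these two facts makes
   both deviations decrease geometrically; then [x_3] tends to 1/2, and the drift
   of [x_1] has asymptotically the sign of minus the cubic. *)
Require Import Defs.
From HB Require Import structures.
From mathcomp Require Import all_boot all_order all_algebra.
From mathcomp Require Import all_classical all_reals all_analysis.
From mathcomp Require Import ring lra.

Set Implicit Arguments.
Unset Strict Implicit.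
Unset Printing Implicit Defensive.

Import Order.TTheory GRing.Theory Num.Theory.
Import numFieldNormedType.Exports.

Local Open Scope classical_set_scope.
Local Open Scope ring_scope.

(** * Expectations along the tree of histories *)

Section RealProbability.
Context d (T : measurableType d) (R : realType) (P : probability T R).

Definition pr (A : set T) : R := fine (P A).

Lemma prE A : measurable A -> P A = (pr A)%:E.
Proof. by move=> mA; rewrite /pr fineK // fin_num_measure. Qed.

Lemma pr_ge0 A : 0 <= pr A.
Proof. exact: fine_ge0. Qed.

Lemma pr0 : pr set0 = 0.
Proof. by rewrite /pr measure0. Qed.

Lemma le_pr A B : measurable A -> measurable B -> A `<=` B -> pr A <= pr B.
Proof. by move=> mA mB AB; rewrite -lee_fin -!prE //; apply: le_measure; rewrite ?inE. Qed.

Lemma prU A B : measurable A -> measurable B -> pr (A `|` B) = pr A + pr B - pr (A `&` B).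
Proof.
move=> mA mB; apply/EFin_inj; rewrite EFinB EFinD -!prE//; last 2 first.
- exact: measurableI.
- exact: measurableU.
by rewrite measureUfinl // (le_lt_trans (probability_le1 P mA)) // ltry.
Qed.

Lemma pr_partition (S : finType) (Y : T -> S) (A : set T) :
  measurable A -> (forall x, measurable [set t | Y t = x]) ->
  pr A = \sum_(x : S) pr (A `&` [set t | Y t = x]).
Proof.
move=> mA mY; apply/EFin_inj; rewrite -prE // -sumEFin.
rewrite {1}(_ : A = \bigcup_(x in [set: S]) (A `&` [set t | Y t = x])); last first.
  by rewrite predeqE => t; split => [At|[x _ []]//]; exists (Y t).
rewrite measure_fin_bigcup //=.
- have -> : [set: S] = [set` index_enum S].
    by rewrite predeqE => x; split => //= _; rewrite mem_index_enum.
  rewrite -fsbig_seq ?index_enum_uniq //; apply: eq_bigr => x _.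
  by rewrite -prE //; apply: measurableI.
- by move=> x y _ _ [t [[_ <-] [_ <-]]].
- by move=> x _; exact: measurableI.
Qed.

Lemma pr_bigcup (A : (set T)^nat) (c : R) :
  (forall n, measurable (A n)) -> nondecreasing_seq A ->
  (fun n => pr (A n)) @ \oo --> c -> pr (\bigcup_n A n) = c.
Proof.
move=> mA ndA cA; apply/EFin_inj; rewrite -prE; last exact: bigcupT_measurable.
have cA' : (fun n => P (A n)) @ \oo --> c%:E.
  by rewrite (_ : (fun n => _) = EFin \o (fun n => pr (A n)));
    [apply: cvg_EFin; [by near=> n|]|apply/funext => n /=; rewrite -prE].
have cP : (P \o A) @ \oo --> P (\bigcup_n A n).
  by apply: nondecreasing_cvg_mu => //; exact: bigcupT_measurable.
by rewrite -(cvg_lim (@ereal_hausdorff R) cP) (cvg_lim (@ereal_hausdorff R) cA').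
Unshelve. all: by end_near. Qed.

End RealProbability.

Section History.
Context (T : Type) (S : Type) (X : nat -> T -> S).

(** The newest value comes first, so that one more step of the process is a cons. *)
Fixpoint hist (n : nat) (t : T) : seq S :=
  if n is m.+1 then X m t :: hist m t else [::].

Lemma size_hist n t : size (hist n t) = n.
Proof. by elim: n => //= n ->. Qed.

Definition cyl (h : seq S) : set T := [set t | hist (size h) t = h].

Lemma cyl_nil : cyl [::] = setT.
Proof. by rewrite predeqE. Qed.

Lemma cyl_cons x h : cyl (x :: h) = cyl h `&` [set t | X (size h) t = x].
Proof.
by rewrite predeqE /cyl => t /=; split => [[-> ->]|[-> ->]].
Qed.

Lemma hist_rev n t : hist n t = rev (mkseq (X ^~ t) n).
Proof. by elim: n => //= n ->; rewrite mkseqS rev_rcons. Qed.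

End History.

Lemma measurable_cyl d (T : measurableType d) (S : Type)
    (X : nat -> T -> S) (h : seq S) :
  (forall n x, (n < size h)%N -> measurable [set t | X n t = x]) ->
  measurable (cyl X h).
Proof.
elim: h => [_|x h IH mX]; first by rewrite cyl_nil.
rewrite cyl_cons; apply: measurableI; last exact: mX.
by apply: IH => n y nh; apply: mX; exact: ltnW.
Qed.

Section Tree.
Context d (T : measurableType d) (R : realType) (P : probability T R).
Context (S : finType) (X : nat -> T -> S) (H : set T).
Hypothesis mX : forall n x, measurable [set t | X n t = x].
Hypothesis mH : measurable H.

Let mcyl h : measurable (cyl X h).
Proof. by apply: measurable_cyl. Qed.

(** The event [H] serves two uses: it is the whole space for the sequence of traces, and an event of
    the past for the steps of a single walk. *)
Definition mass (h : seq S) : R := pr P (H `&` cyl X h).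

(* [expect n f [::]] is the integral over [H] of [f] applied to the first [n]
   values of [X], the most recent one coming first. *)
Fixpoint expect (n : nat) (f : seq S -> R) (h : seq S) : R :=
  if n is m.+1 then \sum_(x : S) expect m f (x :: h) else mass h * f h.

Lemma mass_ge0 h : 0 <= mass h.
Proof. exact: pr_ge0. Qed.

Lemma mass_cons h : mass h = \sum_(x : S) mass (x :: h).
Proof.
rewrite /mass (pr_partition P (Y := X (size h))) //; last exact: measurableI.
by apply: eq_bigr => x _; rewrite cyl_cons setIA.
Qed.

(** Tower property: [g] is the average of [f] over the next value. The hypothesis keeps the factor
    [mass], so histories of probability 0 require no division. *)
Lemma expectS n f g h :
  (forall h, \sum_(x : S) mass (x :: h) * f (x :: h) = mass h * g h) ->
  expect n.+1 f h = expect n g h.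
Proof.
move=> fg; elim: n h => [|n IH] h; first exact: fg.
by apply: eq_bigr => x _; exact: IH.
Qed.

Lemma expect_le n f g h : (forall h, f h <= g h) -> expect n f h <= expect n g h.
Proof.
move=> fg; elim: n h => [|n IH] h; last by apply: ler_sum => x _; exact: IH.
by apply: ler_wpM2l; [exact: mass_ge0|exact: fg].
Qed.

Lemma expectS_le n f g h :
  (forall h, \sum_(x : S) mass (x :: h) * f (x :: h) <= mass h * g h) ->
  expect n.+1 f h <= expect n g h.
Proof.
move=> fg; elim: n h => [|n IH] h; first exact: fg.
by apply: ler_sum => x _; exact: IH.
Qed.

Lemma expectD n f g h : expect n (fun h => f h + g h) h = expect n f h + expect n g h.
Proof.
elim: n h => [|n IH] h /=; first by rewrite mulrDr.
by rewrite -big_split; apply: eq_bigr => x _; exact: IH.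
Qed.

Lemma expectZ n c f h : expect n (fun h => c * f h) h = c * expect n f h.
Proof.
elim: n h => [|n IH] h /=; first by rewrite mulrCA.
by rewrite mulr_sumr; apply: eq_bigr => x _; exact: IH.
Qed.

Lemma expect_ge0 n f h : (forall h, 0 <= f h) -> 0 <= expect n f h.
Proof.
move=> f0; elim: n h => [|n IH] h /=; last by apply: sumr_ge0 => x _; exact: IH.
by apply: mulr_ge0; rewrite ?mass_ge0.
Qed.

Lemma measurable_hist n (C : pred (seq S)) :
  measurable [set t | C (hist X n t)].
Proof.
(* Starting from an arbitrary history lets the induction on [n] split over the next value. *)
suff: forall h, measurable (cyl X h `&` [set t | C (hist X (n + size h) t)]).
  by move=> /(_ [::]); rewrite cyl_nil setTI addn0.
elim: n => [|n IH] h.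
  case Ch : (C h).
    rewrite (_ : _ `&` _ = cyl X h) // predeqE /cyl => t /=.
    by split => [[]//|ht]; rewrite add0n ht.
  rewrite (_ : _ `&` _ = set0) // predeqE /cyl => t /=.
  by split => // -[]; rewrite add0n => ->; rewrite Ch.
rewrite (_ : _ `&` _ = \bigcup_(x in [set: S])
    (cyl X (x :: h) `&` [set t | C (hist X (n + size (x :: h)) t)])).
  by apply: (@fin_bigcup_measurable _ _ S) => // x _; exact: IH.
rewrite predeqE => t; split => [[ht Ct]|[x _]].
  by exists (X (size h) t) => //; rewrite cyl_cons /= addnS -addSn.
by rewrite cyl_cons /= addnS -addSn => -[[]].
Qed.

Lemma expect_pred n (C : pred (seq S)) :
  expect n (fun h => (C h)%:R) [::] = pr P (H `&` [set t | C (hist X n t)]).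
Proof.
suff E : forall h, expect n (fun h => (C h)%:R) h =
    pr P (H `&` cyl X h `&` [set t | C (hist X (n + size h) t)]).
  by rewrite E cyl_nil setIT addn0.
elim: n => [|n IH] h /=.
  rewrite add0n /mass; case Ch : (C h); rewrite ?mulr1 ?mulr0.
    congr (pr P _); rewrite predeqE /cyl => t /=.
    by split => [[Ht ht]|[]//]; rewrite ht.
  rewrite [X in pr P X](_ : _ = set0) ?pr0 // predeqE /cyl => t /=.
  by split => // -[[_ ->]]; rewrite Ch.
rewrite [RHS](pr_partition P (Y := X (size h))) //; last first.
  apply: measurableI; last exact: (measurable_hist (n.+1 + size h) C).
  exact: measurableI.
apply: eq_bigr => x _; rewrite IH; congr (pr P _).
rewrite cyl_cons /= addnS predeqE /cyl => t /=; tauto.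
Qed.

End Tree.

(** * Almost sure convergence of martingales *)

Lemma pr_bigcup_le d (T : measurableType d) (R : realType) (P : probability T R)
    (A : (set T)^nat) (c : R) :
  (forall n, measurable (A n)) -> nondecreasing_seq A ->
  (forall n, pr P (A n) <= c) -> pr P (\bigcup_n A n) <= c.
Proof.
move=> mA ndA Ac.
have cA : cvgn (fun n => pr P (A n)).
  apply: nondecreasing_is_cvgn; last by exists c => _ [n _ <-].
  by move=> m n mn; apply: le_pr => //; apply/subsetPset/ndA.
rewrite (pr_bigcup mA ndA cA); apply: limr_le => //.
by near=> n.
Unshelve. all: by end_near. Qed.

Lemma ae_pr0 d (T : measurableType d) (R : realType) (P : probability T R)
    (B : set T) (Q : T -> Prop) :
  measurable B -> pr P B = 0 -> (forall t, ~ Q t -> B t) -> {ae P, forall t, Q t}.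
Proof. by move=> mB B0 QB; exists B; split => //; rewrite prE // B0. Qed.

Lemma eq_expect d (T : measurableType d) (R : realType) (P : probability T R)
    (S : finType) (X : nat -> T -> S) (H : set T) n (f g : seq S -> R) h :
  (forall h', size h' = (n + size h)%N -> f h' = g h') ->
  expect P X H n f h = expect P X H n g h.
Proof.
elim: n h => [|n IH] h fg /=; first by rewrite fg.
by apply: eq_bigr => x _; apply: IH => h' /= sh'; apply: fg; rewrite sh' addnS.
Qed.

(** Cauchy's criterion with countably many tolerances, so that almost sure statements can be proved
    for one tolerance at a time. *)
Lemma cvgn_tail (R : realType) (u : R^nat) :
  (forall j, exists m, forall n, (m <= n)%N -> `|u n - u m| <= j.+1%:R^-1) ->
  cvgn u.
Proof.
move=> hu; apply: (@cauchy_cvg R); apply: cauchy_exP => e e0.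
have [j je] : exists j : nat, j.+1%:R^-1 < e.
  exists (Num.truncn e^-1); rewrite invf_plt ?posrE ?ltr0n //.
  exact: truncnS_gt.
have [m hm] := hu j; exists (u m); exists m => // n /= mn.
by rewrite /ball /= distrC (le_lt_trans (hm _ mn)).
Qed.

Section MartingaleConvergence.
Context d (T : measurableType d) (R : realType) (P : probability T R).
Context (S : finType) (X : nat -> T -> S).
Hypothesis mX : forall n x, measurable [set t | X n t = x].
(** [D] is a martingale difference, and the expected drop of the potential [U] pays for its
    conditional variance; no separate bound on the sum of the variances is required. *)
Context (D : S -> seq S -> R) (U : seq S -> R).
Hypothesis D0 : forall h,
  \sum_(x : S) mass P X setT (x :: h) * D x h = 0.
Hypothesis U0 : forall h, 0 <= U h.
Hypothesis DU : forall h,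
  \sum_(x : S) mass P X setT (x :: h) * (D x h ^+ 2 + U (x :: h))
    <= mass P X setT h * U h.

Let E n f := expect P X setT n f [::].

(* Freezing the sum once it exceeds [e] turns the maximal inequality into
   Chebyshev's inequality at a fixed time. *)
Fixpoint stopped_sum (m : nat) (e : R) (h : seq S) : R :=
  if h is x :: h' then
    let s := stopped_sum m e h' in
    s + (if (m <= size h')%N && (`|s| <= e) then D x h' else 0)
  else 0.

Let run_early m e h : (size h <= m)%N -> stopped_sum m e h = 0.
Proof.
elim: h => //= x h IH hm; rewrite IH; last exact: ltnW.
by rewrite leqNgt hm /= addr0.
Qed.

Let EU_le n : E n.+1 U <= E n U.
Proof.
apply: expectS_le => h; apply: le_trans (DU h).
by apply: ler_sum => x _; rewrite ler_wpM2l ?mass_ge0 // lerDr sqr_ge0.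
Qed.

Let energy m e h := stopped_sum m e h ^+ 2 + U h.

(** A running step converts lost potential into variance, and a frozen step can only lower the
    expected potential. *)
Let energy_le m e n : E n.+1 (energy m e) <= E n (energy m e).
Proof.
apply: expectS_le => h.
change (\sum_(x : S) mass P X setT (x :: h) * (stopped_sum m e (x :: h) ^+ 2 + U (x :: h))
  <= mass P X setT h * (stopped_sum m e h ^+ 2 + U h)); rewrite /=.
set s := stopped_sum m e h; case: ((m <= size h)%N && (`|s| <= e)).
  rewrite (eq_bigr (fun x => mass P X setT (x :: h) * s ^+ 2 +
     (2 * s) * (mass P X setT (x :: h) * D x h) +
     mass P X setT (x :: h) * (D x h ^+ 2 + U (x :: h)))); last first.
    by move=> x _; ring.
  have := DU h; rewrite !big_split /= -mulr_suml -mulr_sumr D0 -mass_cons //; lra.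
rewrite (eq_bigr (fun x => mass P X setT (x :: h) * s ^+ 2 +
     mass P X setT (x :: h) * U (x :: h))); last by move=> x _; ring.
rewrite big_split /= -mulr_suml -mass_cons // mulrDr lerD2l.
apply: le_trans (DU h).
by apply: ler_sum => x _; rewrite ler_wpM2l ?mass_ge0 // lerDr sqr_ge0.
Qed.

Let EU_cvg : cvgn (fun n => E n U).
Proof.
apply: nonincreasing_is_cvgn.
  by apply/nonincreasing_seqP => n; exact: EU_le.
by exists 0 => _ [n _ <-]; apply: expect_ge0.
Qed.

(** Chebyshev's inequality: since the stopped sum vanishes up to time [m], its second moment at time
    [n] is at most the expected potential lost between [m] and [n]. The resulting bound is uniform
    in [n] and tends to 0 as [m] grows. *)
Let run_le m e n : 0 < e ->
  pr P [set t | e < `|stopped_sum m e (hist X n t)|]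
    <= e ^- 2 * (E m U - limn (fun n => E n U)).
Proof.
move=> e0.
have lim_le k : limn (fun n => E n U) <= E k U.
  apply: nonincreasing_cvgn_ge => //.
  by apply/nonincreasing_seqP => i; exact: EU_le.
case: (leqP n m) => nm.
  rewrite [X in pr P X](_ : _ = set0) ?pr0.
    by rewrite mulr_ge0 ?subr_ge0 // invr_ge0 exprn_ge0 // ltW.
  rewrite predeqE => t /=; split => //.
  by rewrite run_early ?size_hist // normr0 ltNge (ltW e0).
have <- : pr P (setT `&` [set t | e < `|stopped_sum m e (hist X n t)|]) =
    pr P [set t | e < `|stopped_sum m e (hist X n t)|] by rewrite setTI.
rewrite -(expect_pred P mX measurableT n (fun h => e < `|stopped_sum m e h|)).
apply: (@le_trans _ _ (E n (fun h => e ^- 2 * stopped_sum m e h ^+ 2))).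
  apply: expect_le => h; case: ltP => /= [es|_]; last first.
    by rewrite mulr_ge0 ?sqr_ge0 // invr_ge0 exprn_ge0 // ltW.
  rewrite mulrC ler_pdivlMr ?exprn_gt0 // mul1r -[leRHS]real_normK ?num_real //.
  by apply: lerXn2r; rewrite ?nnegrE // ltW.
rewrite /E expectZ ler_wpM2l ?invr_ge0 ?exprn_ge0 ?(ltW e0) //.
have nE k : E (m + k) (energy m e) <= E m U.
  elim: k => [|k IH]; last by rewrite addnS (le_trans (energy_le _ _ _)).
  rewrite addn0 /E (@eq_expect _ _ _ _ _ _ _ _ _ U) // => h.
  by rewrite addn0 => sh; rewrite /energy run_early ?sh // expr0n add0r.
have := nE (n - m)%N; rewrite subnKC ?(ltnW nm) // /energy /E expectD.
by have := lim_le n; rewrite /E; lra.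
Qed.

Let msum n t := \sum_(k < n) D (X k t) (hist X k t).

Let run_msum m e t n : (m <= n)%N ->
  (forall k, `|stopped_sum m e (hist X k t)| <= e) ->
  stopped_sum m e (hist X n t) = msum n t - msum m t.
Proof.
move=> mn small; elim: n mn => [|n IH].
  by rewrite leqn0 => /eqP ->; rewrite /= subrr.
rewrite leq_eqVlt => /orP[/eqP<-|mn].
  by rewrite run_early ?size_hist // subrr.
rewrite /= size_hist -ltnS mn small /= IH // /msum big_ord_recr /=.
by rewrite addrAC.
Qed.

(** Outside a null set, for each tolerance some sum started at a time [m] never exceeds it. That sum
    is then never frozen and equals the true increment since [m], which is Cauchy's criterion. *)
Lemma martingale_cvg :
  {ae P, forall t, cvgn (fun n => \sum_(k < n) D (X k t) (hist X k t))}.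
Proof.
pose A m j n := [set t | j.+1%:R^-1 < `|stopped_sum m j.+1%:R^-1 (hist X n t)|].
have mA m j n : measurable (A m j n).
  exact: (measurable_hist mX n (fun h => j.+1%:R^-1 < `|stopped_sum m j.+1%:R^-1 h|)).
have mB m j : measurable (\bigcup_n A m j n) by exact: bigcupT_measurable.
have mC j : measurable (\bigcap_m \bigcup_n A m j n) by exact: bigcapT_measurable.
have C0 j : pr P (\bigcap_m \bigcup_n A m j n) = 0.
  apply/eqP; rewrite eq_le pr_ge0 andbT.
  have j0 : 0 < j.+1%:R^-1 :> R by rewrite invr_gt0.
  have -> : 0 = j.+1%:R^-1 ^- 2 * (limn (fun n => E n U) - limn (fun n => E n U)).
    by rewrite subrr mulr0.
  have : (fun m => j.+1%:R^-1 ^- 2 * (E m U - limn (fun n => E n U))) @ \oo -->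
      j.+1%:R^-1 ^- 2 * (limn (fun n => E n U) - limn (fun n => E n U)).
    by apply: cvgMr; apply: cvgB => //; exact: cvg_cst.
  move=> cE; rewrite -(cvg_lim (@Rhausdorff R) cE); apply: limr_ge; first exact: cvgP cE.
  near=> m; apply: le_trans (pr_bigcup_le (mA m j) _ (fun n => run_le m n j0)).
    by apply: le_pr => // t /(_ m I).
  (* A frozen sum keeps its value, so the events increase with [n] and the bound at fixed times
     passes to their union. *)
  apply/nondecreasing_seqP => n; apply/subsetPset => t.
  rewrite /A /= => jt; rewrite (leNgt _ j.+1%:R^-1) jt /= andbF addr0.
  exact: jt.
have key j : {ae P, forall t, exists m, forall n, (m <= n)%N ->
    `|msum n t - msum m t| <= j.+1%:R^-1}.
  apply: (ae_pr0 (mC j) (C0 j)) => t; apply: contra_notP.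
  move=> /existsNP[m]; rewrite not_implyP => -[_ hm].
  have small k : `|stopped_sum m j.+1%:R^-1 (hist X k t)| <= j.+1%:R^-1.
    by rewrite leNgt; apply/negP => jk; apply: hm; exists k.
  by exists m => n mn; rewrite -(run_msum mn small).
by apply: filterS (ae_foralln key) => t; exact: cvgn_tail.
Unshelve. all: by end_near. Qed.

End MartingaleConvergence.

(** * Hitting probabilities of the walk *)

Lemma sum_option (R : realType) (E : finType) (F : option E -> R) :
  \sum_(o : option E) F o = F None + \sum_(e : E) F (Some e).
Proof.
rewrite (bigD1 None) //=; congr (_ + _).
rewrite (reindex_omap Some id) //=; last by case.
by apply: eq_bigl => e; rewrite eqxx.
Qed.

Section StepLaw.
Context (G : ant_graph) (R : realType) (w : {ffun edge G -> nat}).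

Definition strength (u : vertex G) : R :=
  \sum_(e : edge G | incident e u) (w e)%:R.

Lemma step_food (f : option (edge G) -> R) :
  \sum_(o : option (edge G)) step_prob R w (food G) o * f o = f None.
Proof.
by rewrite sum_option /= eqxx mul1r big1 ?addr0 // => e _; rewrite mul0r.
Qed.

Lemma step_sum (u : vertex G) (f : option (edge G) -> R) : u != food G ->
  \sum_(o : option (edge G)) step_prob R w u o * f o =
  (strength u)^-1 * \sum_(e : edge G | incident e u) (w e)%:R * f (Some e).
Proof.
move=> uF; rewrite sum_option /= (negPf uF) mul0r add0r mulr_sumr big_mkcond /=.
rewrite [RHS]big_mkcond /=; apply: eq_bigr => e _ /=.
by case: ifP => _; rewrite ?mul0r // /strength mulrCA mulrA mulrC mulrA.
Qed.

Lemma step_mass (u : vertex G) : (u != food G -> strength u != 0) ->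
  \sum_(o : option (edge G)) step_prob R w u o = 1.
Proof.
move=> su; rewrite (eq_bigr (fun o => step_prob R w u o * 1)); last first.
  by move=> o _; rewrite mulr1.
have [->|uF] := eqVneq u (food G); first by rewrite step_food.
rewrite step_sum // (eq_bigr (fun e => (w e)%:R)); last first.
  by move=> e _; rewrite mulr1.
by rewrite mulVf // su.
Qed.

End StepLaw.

Section HittingProbability.
Context (G : ant_graph) (d : measure_display) (T : measurableType d).
Context (R : realType) (P : probability T R).
Context (walk : nat -> nat -> T -> option (edge G)).
Hypothesis hwalk : trace_reinforced_ants P walk.
Context (n : nat) (A : set T) (w : {ffun edge G -> nat}).
Hypothesis mA : measurable A.
Hypothesis pastA : past walk n A.
Hypothesis Aw : A `<=` [set t | weight walk n t = w].
Hypothesis strength_neq0 : forall u, u != food G -> strength R w u != 0.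

Let X := walk n.
Let mX k o : measurable [set t | X k t = o].
Proof. exact: measurable_walk hwalk _ _ _. Qed.

Let pos (h : seq (option (edge G))) := position (rev h).

Let pos_cons o h : pos (o :: h) = move (pos h) o.
Proof. by rewrite /pos /position rev_cons foldl_rcons. Qed.

Let mass_step o h :
  mass P X A (o :: h) = mass P X A h * step_prob R w (pos h) o.
Proof.
(* The weights are constant on [A], so this is one of the events on which [walk_step] conditions;
   the list is reversed because histories are stored newest first. *)
have E : A `&` cyl X h =
    A `&` [set t | weight walk n t = w] `&` starts_with walk n (rev h).
  rewrite (setIidl Aw); congr (_ `&` _); rewrite predeqE => t.
  rewrite /starts_with /cyl /= hist_rev size_rev.
  by split => [{2}<-|->]; rewrite revK.
have mI : measurable (A `&` cyl X h).
  by apply: measurableI => //; apply: measurable_cyl.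
have mI' : measurable (A `&` cyl X h `&` [set t | X (size h) t = o]).
  exact: measurableI.
have := walk_step hwalk w (rev h) o pastA.
rewrite /= -E size_rev (prE P mI) (prE P mI') -EFinM.
by move=> [E']; rewrite /mass cyl_cons setIA.
Qed.

Let expect_step k (f g : seq (option (edge G)) -> R) h :
  (forall h, \sum_o step_prob R w (pos h) o * f (o :: h) = g h) ->
  expect P X A k.+1 f h = expect P X A k g h.
Proof.
move=> fg; apply: expectS => h'; rewrite -fg mulr_sumr.
by apply: eq_bigr => o _; rewrite mass_step mulrA.
Qed.

Context (g : vertex G -> R).
Hypothesis g0 : forall u, 0 <= g u.
Hypothesis g_drift : forall u, u != food G ->
  \sum_(e : edge G | incident e u) (w e)%:R * g (other_end e u)
    <= strength R w u * (g u - 1).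

Let alive k := expect P X A k (fun h => (pos h != food G)%:R) [::].

(** [g] is a Lyapunov function: each step lowers its expectation by at least the probability of
    still being away from the food. These probabilities therefore have a convergent series. *)
Let alive_cvg0 : alive @ \oo --> 0.
Proof.
pose a k := expect P X A k (fun h => g (pos h)) [::].
have alive_mass k : expect P X A k.+1 (fun h => g (pos h)) [::] + alive k <= a k.
  rewrite -lerBrDr /a -mulN1r -expectZ -expectD; apply: expectS_le => h.
  rewrite (eq_bigr (fun o => mass P X A h *
      (step_prob R w (pos h) o * g (move (pos h) o)))); last first.
    by move=> o _; rewrite mass_step pos_cons mulrA.
  rewrite -mulr_sumr ler_wpM2l ?mass_ge0 //.
  have [->|uF] := eqVneq (pos h) (food G).
    by rewrite (step_food w (fun o => g (move _ o))) mulr0 addr0.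
  rewrite (step_sum w (fun o => g (move _ o))) //= mulr1.
  rewrite ler_pdivrMl; first exact: g_drift.
  by rewrite lt_neqAle eq_sym strength_neq0 //= sumr_ge0.
have sE k : series alive k <= a 0%N - a k.
  rewrite seriesEord /=; elim: k => [|k IH]; first by rewrite big_ord0 subrr.
  by rewrite big_ord_recr /=; have := alive_mass k; rewrite -/(a k.+1); lra.
have alive0 k : 0 <= alive k by apply: expect_ge0.
apply: cvg_series_cvg_0; apply: nondecreasing_is_cvgn.
  apply/nondecreasing_seqP => k; rewrite !seriesEord /= big_ord_recr /=.
  by rewrite lerDl.
exists (a 0%N) => _ [k _ <-]; rewrite (le_trans (sE k)) // gerBl.
by apply: expect_ge0.
Qed.

(** Let [f] be 1 once an edge of [C] has been crossed, and [v] of the position before that. Its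
    expectation is constant in time, and it differs from the indicator of a crossing only while the
    walk is away from the food, by at most [B]. *)
Lemma hitting_prob (C : pred (edge G)) (v : vertex G -> R) :
  v (food G) = 0 ->
  (forall u, u != food G ->
    \sum_(e : edge G | incident e u)
       (w e)%:R * (if C e then 1 else v (other_end e u)) = strength R w u * v u) ->
  pr P (A `&` [set t | exists2 e, C e & e \in trace walk n t]) =
  pr P A * v (nest G).
Proof.
move=> vF v_harm.
pose hit (h : seq (option (edge G))) := has (fun o => if o is Some e then C e else false) h.
pose f h := if hit h then 1 else v (pos h).
have fE k : expect P X A k f [::] = pr P A * v (nest G).
  elim: k => [|k IH]; first by rewrite /= /mass cyl_nil setIT.
  rewrite -IH; apply: expect_step => h; rewrite /f /=.
  case: (hit h).
    under eq_bigr do rewrite orbT mulr1.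
    by rewrite step_mass //; exact: strength_neq0.
  under eq_bigr do rewrite orbF pos_cons.
  have [->|uF] := eqVneq (pos h) (food G).
    rewrite (step_food w (fun o => if match o with Some e => C e | None => false end
      then 1 else v (move _ o))) //.
  rewrite (step_sum w (fun o => if match o with Some e => C e | None => false end
      then 1 else v (move _ o))) //= v_harm // mulKf //; exact: strength_neq0.
pose B := \sum_u `|v u|.
have vB u : `|v u| <= B.
  by rewrite /B (bigD1 u) //= lerDl sumr_ge0.
pose hits k := pr P (A `&` [set t | hit (hist X k t)]).
have hitsE k : hits k = expect P X A k (fun h => (hit h)%:R) [::].
  by rewrite expect_pred.
have lo k : pr P A * v (nest G) - B * alive k <= hits k.
  rewrite -(fE k) hitsE -expectZ lerBlDr -expectD; apply: expect_le => h.
  rewrite /f; case: (hit h) => /=.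
    by rewrite lerDl mulr_ge0 // sumr_ge0.
  have [->|_] := eqVneq (pos h) (food G); first by rewrite vF mulr0 addr0.
  by rewrite add0r mulr1 (le_trans (ler_norm _)).
have up k : hits k <= pr P A * v (nest G) + B * alive k.
  rewrite -(fE k) hitsE -expectZ -expectD; apply: expect_le => h.
  rewrite /f; case: (hit h) => /=.
    by rewrite lerDl mulr_ge0 // sumr_ge0.
  have [->|_] := eqVneq (pos h) (food G); first by rewrite vF mulr0 addr0.
  by rewrite mulr1 -lerBlDl sub0r (le_trans (ler_norm _)) // normrN.
have hits_cvg : hits @ \oo --> pr P A * v (nest G).
  have Ba : (fun k => B * alive k) @ \oo --> B * 0 by apply: cvgMr.
  apply: (@squeeze_cvgr _ _ _ _
    (fun k => pr P A * v (nest G) - B * alive k)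
    (fun k => pr P A * v (nest G) + B * alive k)).
  - by near=> k; rewrite lo up.
  - rewrite -[X in _ --> X]subr0 -[X in _ - X](mulr0 B).
    by apply: cvgB => //; exact: cvg_cst.
  - rewrite -[X in _ --> X]addr0 -[X in _ + X](mulr0 B).
    by apply: cvgD => //; exact: cvg_cst.
rewrite -(pr_bigcup _ _ hits_cvg).
- congr (pr P _); rewrite -setI_bigcupr; congr (_ `&` _).
  rewrite predeqE => t; split.
    move=> [e Ce]; rewrite inE => /asboolP[k ek]; exists k.+1 => //=.
    by rewrite /X ek Ce.
  move=> [k _] /hasP[[e|//]]; rewrite hist_rev mem_rev => /mapP[j _ ej] Ce.
  by exists e => //; rewrite inE; apply/asboolP; exists j.
- by move=> k; apply: measurableI => //; exact: (measurable_hist mX k hit).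
- apply/nondecreasing_seqP => k; apply/subsetPset => t [At] /= hk.
  by split => //=; rewrite /hit /= in hk *; rewrite hk orbT.
Unshelve. all: by end_near. Qed.

End HittingProbability.

(** * Crossing probabilities in the lozenge *)

Section TraceHistory.
Context (G : ant_graph) (T : Type) (walk : nat -> nat -> T -> option (edge G)).

Fixpoint weight_of (h : seq {set edge G}) : {ffun edge G -> nat} :=
  if h is x :: h' then [ffun e => (weight_of h' e + (e \in x))%N]
  else [ffun=> 1%N].

Lemma weight_hist n t : weight walk n t = weight_of (hist (trace walk) n t).
Proof. by elim: n => //= n ->. Qed.

Lemma weight_of_gt0 h e : (0 < weight_of h e)%N.
Proof. by elim: h => [|x h IH]; rewrite ffunE // addn_gt0 IH. Qed.

End TraceHistory.

Lemma measurable_trace (G : ant_graph) d (T : measurableType d)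
    (walk : nat -> nat -> T -> option (edge G)) n :
  (forall k o, measurable [set t | walk n k t = o]) ->
  forall x, measurable [set t | trace walk n t = x].
Proof.
move=> mw x.
have me e : measurable [set t | e \in trace walk n t].
  rewrite (_ : [set t | _] = \bigcup_k [set t | walk n k t = Some e]).
    exact: bigcupT_measurable.
  rewrite predeqE => t /=; rewrite inE; split => [/asboolP[k ek]|[k _ ek]].
    by exists k.
  by apply/asboolP; exists k.
rewrite (_ : [set t | _] = \bigcap_(e in [set: edge G])
    (if e \in x then [set t | e \in trace walk n t]
     else ~` [set t | e \in trace walk n t])).
  apply: (@fin_bigcap_measurable _ _ (edge G)) => // e _.
  by case: ifP => _ //; apply: measurableC.
rewrite predeqE => t /=; split => [tx e _|H].
  by rewrite -tx; case: ifP => //= ->.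
by apply/setP => e; have := H e I; case: ifP => //= _ /negP/negPf.
Qed.

(** The measurability lemmas are applied with [T] carrying the sigma-algebra generated by the
    earlier walks instead of its own. *)
Lemma past_trace_cyl (G : ant_graph) d (T : measurableType d)
    (walk : nat -> nat -> T -> option (edge G)) h :
  past walk (size h) (cyl (trace walk) h).
Proof.
pose M := [set B : set T | exists m k o, (m < size h)%N /\ B = [set t | walk m k t = o]].
suff : measurable (cyl (trace walk) h : set (g_sigma_algebraType M)) by [].
apply: measurable_cyl => m x mh.
apply: (@measurable_trace _ _ (g_sigma_algebraType M)) => k o.
by apply: sub_sigma_algebra; exists m, k, o.
Qed.

Definition edge1 : edge lozenge := @Ordinal 5 0 isT.
Definition edge2 : edge lozenge := @Ordinal 5 1 isT.
Definition edge3 : edge lozenge := @Ordinal 5 2 isT.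
Definition edge4 : edge lozenge := @Ordinal 5 3 isT.
Definition edge5 : edge lozenge := @Ordinal 5 4 isT.

Lemma lozenge_vertex (Q : vertex lozenge -> Prop) :
  Q lozN -> Q lozP2 -> Q lozP5 -> forall u, u != food lozenge -> Q u.
Proof.
move=> QN Q2 Q5 [[|[|[|[|//]]]] i] //= _.
- by rewrite (_ : Ordinal i = lozN) //; exact: val_inj.
- by rewrite (_ : Ordinal i = lozP2) //; exact: val_inj.
- by rewrite (_ : Ordinal i = lozP5) //; exact: val_inj.
Qed.

Lemma sum_lozenge_edges (V : nmodType) (Q : pred (edge lozenge)) (F : edge lozenge -> V) :
  \sum_(e | Q e) F e =
  (if Q edge1 then F edge1 else 0) + (if Q edge2 then F edge2 else 0) +
  (if Q edge3 then F edge3 else 0) + (if Q edge4 then F edge4 else 0) +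
  (if Q edge5 then F edge5 else 0).
Proof.
rewrite big_mkcond /= !big_ord_recl big_ord0 addr0 /= !addrA.
by congr (_ + _ + _ + _ + _); congr (if Q _ then F _ else _); apply: val_inj.
Qed.

(** The entries follow the numbering of the vertices: nest, food, [lozP2], [lozP5]. The value at the
    food is always 0. *)
Definition vertex_fun (R : realType) (a b c : R) (u : vertex lozenge) : R :=
  [:: a; 0; b; c]`_u.

Ltac pos_neq0 := rewrite -?andbA; do ?[apply/andP; split];
  apply: lt0r_neq0; rewrite ?(addr_gt0, mulr_gt0).

Section LozengeRates.
Context (R : realType).

(* [w e * rate w e] is the probability that a walk with weights [w] crosses [e],
   by first-step analysis; edges 4 and 5 follow from edges 1 and 2 by the
   reflection of the lozenge that fixes the nest and the food. *)
Definition rate1 (w1 w2 w3 w4 w5 : R) : R :=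
  ((w4 + w5) * (w1 + w2 + w3) + w3 * (w1 + w2 + w4)) /
  ((w1 + w4) * (w5 * (w1 + w2 + w3) + w3 * (w1 + w2)) +
   w1 * w4 * (w1 + w2 + w3)).

Definition rate2 (w1 w2 w3 w4 w5 : R) : R :=
  (w3 * (w1 + w4) + w1 * w4 + w1 * w5) /
  ((w1 + w4) * w2 * w5 + (w3 * (w1 + w4) + w1 * w4) * (w2 + w5)).

Definition rate3 (w1 w2 w3 w4 w5 : R) : R :=
  (w1 * (w3 + w4 + w5) + w4 * (w1 + w2 + w3)) /
  (w1 * (w3 + w4 + w5) * (w2 + w3) + w4 * (w1 + w2 + w3) * (w3 + w5)).

Definition rate (w : edge lozenge -> R) (e : edge lozenge) : R :=
  let: (w1, w2, w3, w4, w5) := (w edge1, w edge2, w edge3, w edge4, w edge5) in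
  [:: rate1 w1 w2 w3 w4 w5; rate2 w1 w2 w3 w4 w5; rate3 w1 w2 w3 w4 w5;
      rate1 w4 w5 w3 w1 w2; rate2 w4 w5 w3 w1 w2]`_e.

Lemma rate_gt0 (w : edge lozenge -> R) e : (forall e, 0 < w e) -> 0 < rate w e.
Proof.
move=> w0; rewrite /rate; case: e => [[|[|[|[|[|//]]]]] i] /=;
  by rewrite divr_gt0 ?(addr_gt0, mulr_gt0).
Qed.

End LozengeRates.

Section LozengeTrace.
Context d (T : measurableType d) (R : realType) (P : probability T R).
Context (walk : nat -> nat -> T -> option (edge lozenge)).
Hypothesis hwalk : trace_reinforced_ants P walk.
Context (n : nat) (A : set T) (w : {ffun edge lozenge -> nat}).
Hypothesis mA : measurable A.
Hypothesis pastA : past walk n A.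
Hypothesis Aw : A `<=` [set t | weight walk n t = w].
Hypothesis w_gt0 : forall e, (0 < w e)%N.

Let w1 : R := (w edge1)%:R.
Let w2 : R := (w edge2)%:R.
Let w3 : R := (w edge3)%:R.
Let w4 : R := (w edge4)%:R.
Let w5 : R := (w edge5)%:R.

Let wge1 e : 1 <= (w e)%:R :> R. Proof. by rewrite ler1n. Qed.

Let strengthN : strength R w lozN = w1 + w4.
Proof. by rewrite /strength sum_lozenge_edges /= !addr0. Qed.
Let strengthP2 : strength R w lozP2 = w1 + w2 + w3.
Proof. by rewrite /strength sum_lozenge_edges /= !addr0. Qed.
Let strengthP5 : strength R w lozP5 = w3 + w4 + w5.
Proof. by rewrite /strength sum_lozenge_edges /= !add0r. Qed.

Let strength_neq0 u : u != food lozenge -> strength R w u != 0.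
Proof.
have [[[[g1 g2] g3] g4] g5] := (wge1 edge1, wge1 edge2, wge1 edge3, wge1 edge4, wge1 edge5).
move: u; apply: lozenge_vertex; apply: lt0r_neq0.
- by rewrite strengthN /w1 /w4; lra.
- by rewrite strengthP2 /w1 /w2 /w3; lra.
- by rewrite strengthP5 /w3 /w4 /w5; lra.
Qed.

Lemma lozenge_hitting_prob (C : pred (edge lozenge)) (a b c : R) :
  a * (w1 + w4) = w1 * (if C edge1 then 1 else b) + w4 * (if C edge4 then 1 else c) ->
  b * (w1 + w2 + w3) = w1 * (if C edge1 then 1 else a) +
    w2 * (if C edge2 then 1 else 0) + w3 * (if C edge3 then 1 else c) ->
  c * (w3 + w4 + w5) = w3 * (if C edge3 then 1 else b) +
    w4 * (if C edge4 then 1 else a) + w5 * (if C edge5 then 1 else 0) ->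
  pr P (A `&` [set t | exists2 e, C e & e \in trace walk n t]) = pr P A * a.
Proof.
have [[[[g1 g2] g3] g4] g5] := (wge1 edge1, wge1 edge2, wge1 edge3, wge1 edge4, wge1 edge5).
move=> EN E2 E5.
(* Lyapunov function for the hitting time of the food: [B + 1] at the nest and [B] at its
   neighbours. At [lozP2] the drift condition reads [2 * w1 + w2 + w3 <= w2 * B], which holds
   because weights are at least 1; [lozP5] is similar. *)
pose B : R := 2 * (w1 + w2 + w3 + w3 + w4 + w5).
have B0 : 0 <= B by rewrite /B /w1 /w2 /w3 /w4 /w5; lra.
apply: (hitting_prob hwalk mA pastA Aw strength_neq0
  (g := vertex_fun (B + 1) B B) _ _ (v := vertex_fun a b c)) => //.
- by case=> [[|[|[|[|//]]]] i]; rewrite /vertex_fun /=; lra.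
- apply: lozenge_vertex.
  + rewrite strengthN sum_lozenge_edges /= /vertex_fun /= -/w1 -/w4; lra.
  + rewrite strengthP2 sum_lozenge_edges /= /vertex_fun /= -/w1 -/w2 -/w3 /B.
    move: g1 g2 g3 g4 g5; rewrite -/w1 -/w2 -/w3 -/w4 -/w5; nra.
  + rewrite strengthP5 sum_lozenge_edges /= /vertex_fun /= -/w3 -/w4 -/w5 /B.
    move: g1 g2 g3 g4 g5; rewrite -/w1 -/w2 -/w3 -/w4 -/w5; nra.
- apply: lozenge_vertex.
  + by rewrite strengthN sum_lozenge_edges /= !addr0 [RHS]mulrC EN.
  + by rewrite strengthP2 sum_lozenge_edges /= !addr0 [RHS]mulrC E2.
  + by rewrite strengthP5 sum_lozenge_edges /= !add0r [RHS]mulrC E5.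
Qed.


Let trace1 (e : edge lozenge) :
  [set t | exists2 e', pred1 e e' & e' \in trace walk n t] =
  [set t | e \in trace walk n t].
Proof.
rewrite predeqE => t; split => [[e' /eqP ->]//|et].
by exists e => //=; rewrite eqxx.
Qed.

(** Each case exhibits the solution of the first-step system at [lozP2] and [lozP5], and [field]
    checks the three equations. *)
Lemma trace_prob (e : edge lozenge) :
  pr P (A `&` [set t | e \in trace walk n t]) =
  pr P A * ((w e)%:R * rate (fun e => (w e)%:R) e).
Proof.
have [[[[g1 g2] g3] g4] g5] := (wge1 edge1, wge1 edge2, wge1 edge3, wge1 edge4, wge1 edge5).
have [[[[p1 p2] p3] p4] p5] : (0 < w1) * (0 < w2) * (0 < w3) * (0 < w4) * (0 < w5).
  by do !split; rewrite ltr0n.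
pose A1 := w1 * (w3 + w4 + w5).
pose A4 := w4 * (w1 + w2 + w3).
pose Den1 := (w1 + w4) * (w5 * (w1 + w2 + w3) + w3 * (w1 + w2)) + w1 * w4 * (w1 + w2 + w3).
pose Den4 := (w4 + w1) * (w2 * (w4 + w5 + w3) + w3 * (w4 + w5)) + w4 * w1 * (w4 + w5 + w3).
pose k := w3 * (w1 + w4) + w1 * w4.
pose Den2 := (w1 + w4) * w2 * w5 + k * (w2 + w5).
pose Den3 := A1 * (w2 + w3) + A4 * (w3 + w5).
rewrite -trace1.
case: e => [[|[|[|[|[|//]]]]] i].
- rewrite (_ : Ordinal i = edge1); last exact: val_inj.
  (* The probability, from [lozP5], of reaching the food without crossing edge 1. *)
  pose a5 := (w1 + w4) * (w5 * (w1 + w2 + w3) + w2 * w3) / Den1.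
  apply: (lozenge_hitting_prob (b := 1 - (w2 + w3 * a5) / (w1 + w2 + w3)) (c := 1 - a5));
    rewrite /= /rate /= /rate1 -/w1 -/w2 -/w3 -/w4 -/w5 /a5 /Den1;
    by field; pos_neq0.
- rewrite (_ : Ordinal i = edge2); last exact: val_inj.
  apply: (lozenge_hitting_prob (b := w2 * ((w1 + w4) * w5 + k) / Den2) (c := k * w2 / Den2));
    rewrite /= /rate /= /rate2 -/w1 -/w2 -/w3 -/w4 -/w5 /Den2 /k;
    by field; pos_neq0.
- rewrite (_ : Ordinal i = edge3); last exact: val_inj.
  (* The probability, from the nest, of never crossing edge 3. *)
  pose q := (A1 * w2 + A4 * w5) / Den3.
  apply: (lozenge_hitting_prob (b := 1 - (w1 * q + w2) / (w1 + w2 + w3))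
      (c := 1 - (w4 * q + w5) / (w3 + w4 + w5)));
    rewrite /= /rate /= /rate3 -/w1 -/w2 -/w3 -/w4 -/w5 /q /Den3 /A1 /A4;
    by field; pos_neq0.
- rewrite (_ : Ordinal i = edge4); last exact: val_inj.
  pose a2 := (w4 + w1) * (w2 * (w3 + w4 + w5) + w5 * w3) / Den4.
  apply: (lozenge_hitting_prob (c := 1 - (w5 + w3 * a2) / (w3 + w4 + w5)) (b := 1 - a2));
    rewrite /= /rate /= /rate1 -/w1 -/w2 -/w3 -/w4 -/w5 /a2 /Den4;
    by field; pos_neq0.
- rewrite (_ : Ordinal i = edge5); last exact: val_inj.
  apply: (lozenge_hitting_prob (c := w5 * ((w1 + w4) * w2 + k) / Den2) (b := k * w5 / Den2));
    rewrite /= /rate /= /rate2 -/w1 -/w2 -/w3 -/w4 -/w5 /Den2 /k;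
    by field; pos_neq0.
Qed.

(** The food can only be entered through edge 2 or edge 5, so the constant 1 solves the first-step
    system. *)
Lemma trace25_prob :
  pr P (A `&` [set t | exists2 e, (e == edge2) || (e == edge5) & e \in trace walk n t])
  = pr P A.
Proof.
rewrite (lozenge_hitting_prob (C := fun e => (e == edge2) || (e == edge5))
  (a := 1) (b := 1) (c := 1)) ?mulr1 //=; by ring.
Qed.

(** The first step out of the nest already crosses edge 1 or edge 4, whence the value 1 there. *)
Lemma trace14_prob :
  pr P (A `&` [set t | exists2 e, (e == edge1) || (e == edge4) & e \in trace walk n t])
  = pr P A.
Proof.
have [[[[g1 g2] g3] g4] g5] := (wge1 edge1, wge1 edge2, wge1 edge3, wge1 edge4, wge1 edge5).
have [[[[p1 p2] p3] p4] p5] : (0 < w1) * (0 < w2) * (0 < w3) * (0 < w4) * (0 < w5).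
  by do !split; rewrite ltr0n.
pose Den := w3 * (w1 + w2 + w4 + w5) + (w1 + w2) * (w4 + w5).
rewrite (lozenge_hitting_prob (C := fun e => (e == edge1) || (e == edge4))
  (a := 1) (b := (w1 * (w3 + w4 + w5) + w3 * w4) / Den)
  (c := (w4 * (w1 + w2 + w3) + w3 * w1) / Den)) ?mulr1 //=; first by ring.
all: by rewrite /Den; field; pos_neq0.
Qed.

End LozengeTrace.

(** * Almost sure properties of the traces *)

Lemma ae_forall_count d (T : measurableType d) (R : realType)
    (P : probability T R) (I : countType) (Q : I -> T -> Prop) :
  (forall i, {ae P, forall t, Q i t}) -> {ae P, forall t, forall i, Q i t}.
Proof.
move=> QP; suff : {ae P, forall t, forall k i, unpickle k = Some i -> Q i t}.
  by apply: filterS => t H i; exact: H (pickleK i).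
apply: ae_foralln => k; case: (unpickle k) => [i|]; last exact: aeW.
by apply: filterS (QP i) => t Qi j [<-].
Qed.

Section AlmostSure.
Context d (T : measurableType d) (R : realType) (P : probability T R).
Context (walk : nat -> nat -> T -> option (edge lozenge)).
Hypothesis hwalk : trace_reinforced_ants P walk.

Let X := trace walk.
Let W n t e : R := (weight walk n t e)%:R.

Let mX n x : measurable [set t | X n t = x].
Proof. by apply: measurable_trace => k o; exact: measurable_walk hwalk _ _ _. Qed.

Let mXe n e : measurable [set t | e \in X n t].
Proof.
rewrite (_ : [set t | _] = \bigcup_(x in [set x : {set edge lozenge} | e \in x]) [set t | X n t = x]).
  by apply: (@fin_bigcup_measurable _ _ {set edge lozenge}).
by rewrite predeqE => t /=; split => [eX|[x ex ->]//]; exists (X n t).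
Qed.

Let mcyl h : measurable (cyl X h).
Proof. by apply: measurable_cyl. Qed.

Let past_cyl h : past walk (size h) (cyl X h).
Proof. exact: past_trace_cyl. Qed.

Let cyl_weight h : cyl X h `<=` [set t | weight walk (size h) t = weight_of h].
Proof. by move=> t; rewrite /cyl /= weight_hist -/X => ->. Qed.

Let cyl_trace_prob h e : pr P (cyl X h `&` [set t | e \in X (size h) t]) =
  pr P (cyl X h) *
  ((weight_of h e)%:R * rate (fun e => (weight_of h e)%:R) e).
Proof. by apply: trace_prob => //; exact: weight_of_gt0. Qed.

Let massE h : mass P X setT h = pr P (cyl X h).
Proof. by rewrite /mass setTI. Qed.

Let sum_mass_mem h e :
  \sum_x mass P X setT (x :: h) * (e \in x)%:R =
  mass P X setT h *
  ((weight_of h e)%:R * rate (fun e => (weight_of h e)%:R) e).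
Proof.
rewrite massE -cyl_trace_prob (pr_partition P (Y := X (size h))) //; last first.
  exact: measurableI.
apply: eq_bigr => x _; rewrite massE cyl_cons.
case ex : (e \in x); rewrite ?mulr1 ?mulr0.
  congr (pr P _); rewrite predeqE => t /=.
  by split => [[ct xX]|[[ct _] xX]]; rewrite ?xX ?ex.
rewrite [X in pr P X](_ : _ = set0) ?pr0 // predeqE => t /=.
by split => // -[[_ eX] xX]; rewrite -xX eX in ex.
Qed.

Lemma trace_martingale_cvg e : {ae P, forall t,
  cvgn (fun n => \sum_(k < n) ((e \in X k t)%:R / W k t e - rate (W k t) e))}.
Proof.
pose w (h : seq {set edge lozenge}) e : R := (weight_of h e)%:R.
pose D (x : {set edge lozenge}) h : R := (e \in x)%:R / w h e - rate (w h) e.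
(* With the factor 2, the balance [1 / w - 2 / (w + 1)] between the variance and the drop of the
   potential is nonpositive for every [w >= 1]. *)
pose U h : R := 2 / w h e.
have w1 h : 1 <= w h e by rewrite ler1n weight_of_gt0.
have w0 h : w h e != 0 by rewrite lt0r_neq0 // (lt_le_trans _ (w1 h)).
have := @martingale_cvg _ _ _ P _ X mX D U.
have D0 h : \sum_x mass P X setT (x :: h) * D x h = 0.
  rewrite (eq_bigr (fun x => (w h e)^-1 * (mass P X setT (x :: h) * (e \in x)%:R) -
      mass P X setT (x :: h) * rate (w h) e)); last first.
    by move=> x _; rewrite /D; ring.
  rewrite big_split /= sumrN -mulr_sumr -mulr_suml -mass_cons // sum_mass_mem.
  by rewrite -/(w h e) -/(w h); field; exact: w0.
have U0 h : 0 <= U h by rewrite divr_ge0 // (le_trans _ (w1 h)).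
have DU h : \sum_x mass P X setT (x :: h) * (D x h ^+ 2 + U (x :: h)) <=
    mass P X setT h * U h.
  pose r := rate (w h) e; pose m := mass P X setT.
  (* The indicator of [e \in x] is its own square, so [D x h ^+ 2 + U (x :: h)] is affine in it; [c]
     is the slope. *)
  pose c := (w h e) ^- 2 - 2 * r / w h e - 2 / (w h e * (w h e + 1)).
  rewrite (eq_bigr (fun x => c * (m (x :: h) * (e \in x)%:R) +
      m (x :: h) * (r ^+ 2 + U h))); last first.
    move=> x _; rewrite /U /D /c -/r -/(m _) /w /= ffunE natrD -/(w h e).
    have w10 : w h e + 1 != 0 by rewrite lt0r_neq0 // ltr_wpDl // (le_trans _ (w1 h)).
    by case: (e \in x) => /=; rewrite ?addr0; field; rewrite w0 ?w10.
  rewrite big_split /= -mulr_sumr -mulr_suml /m -mass_cons // sum_mass_mem.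
  rewrite -/(w h e) -/(w h) -/r.
  set M := mass P X setT h.
  rewrite [leLHS](_ : _ = M * (c * w h e * r + r ^+ 2) + M * U h); last by ring.
  rewrite gerDr mulr_ge0_le0 ?mass_ge0 //.
  have r0 : 0 < r.
    by apply: rate_gt0 => e'; rewrite ltr0n weight_of_gt0.
  have -> : c * w h e * r + r ^+ 2 = r * ((1 - w h e) / (w h e * (w h e + 1)) - r).
    have w10 : w h e + 1 != 0 by rewrite lt0r_neq0 // ltr_wpDl // (le_trans _ (w1 h)).
    by rewrite /c; field; rewrite w0 w10.
  rewrite pmulr_rle0 // subr_le0 (le_trans _ (ltW r0)) //.
  have w00 : 0 < w h e by rewrite (lt_le_trans _ (w1 h)).
  by rewrite mulr_le0_ge0 ?subr_le0 // invr_ge0 mulr_ge0 ?addr_ge0 // ltW.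
move=> /(_ D0 U0 DU); apply: filterS => t ct.
rewrite (_ : (fun n => _) = (fun n => \sum_(k < n) D (X k t) (hist X k t))) //.
apply/funext => n; apply: eq_bigr => k _.
by rewrite /D /W weight_hist.
Qed.


(** Within a cylinder the union of the two crossing events has full mass, while the two crossing
    probabilities add up to 1; inclusion-exclusion makes their intersection null. There are
    countably many histories. *)
Lemma trace25 : {ae P, forall t, forall n,
  (edge2 \in X n t) = ~~ (edge5 \in X n t)}.
Proof.
have good h : {ae P, forall t,
    cyl X h t -> (edge2 \in X (size h) t) = ~~ (edge5 \in X (size h) t)}.
  pose A := cyl X h; pose n := size h.
  pose A2 := A `&` [set t | edge2 \in X n t].
  pose A5 := A `&` [set t | edge5 \in X n t].
  have mA2 : measurable A2 by exact: measurableI (mcyl h) (mXe _ _).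
  have mA5 : measurable A5 by exact: measurableI (mcyl h) (mXe _ _).
  have U25 : pr P (A2 `|` A5) = pr P A.
    rewrite -(trace25_prob hwalk (mcyl h) (@past_cyl h) (@cyl_weight h) (weight_of_gt0 h)).
    congr (pr P _); rewrite -setIUr; congr (_ `&` _); rewrite predeqE => t.
    split => [[e2|e5]|[e /orP[/eqP->|/eqP->]]].
    - by exists edge2.
    - by exists edge5.
    - by left.
    - by right.
  have I25 : pr P (A2 `&` A5) = 0.
    pose w e : R := (weight_of h e)%:R.
    have w0 e : 0 < w e by rewrite ltr0n weight_of_gt0.
    have p2 : w edge2 * rate w edge2 = 1 - w edge5 * rate w edge5.
      have [[[[v1 v2] v3] v4] v5] := (w0 edge1, w0 edge2, w0 edge3, w0 edge4, w0 edge5).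
      by rewrite /rate /= /rate2; field; pos_neq0.
    have := prU P mA2 mA5.
    by rewrite U25 [pr P A2]cyl_trace_prob [pr P A5]cyl_trace_prob p2 -/A; lra.
  have mU : measurable (A2 `|` A5) by exact: measurableU.
  have mI : measurable (A2 `&` A5) by exact: measurableI.
  have mD : measurable (A `\` (A2 `|` A5)) by exact: measurableD (mcyl h) mU.
  apply: (@ae_pr0 _ _ _ _ ((A `\` (A2 `|` A5)) `|` (A2 `&` A5))).
  - exact: measurableU mD mI.
  - have AU : A = (A2 `|` A5) `|` (A `\` (A2 `|` A5)).
      rewrite predeqE => t; split => [At|[[[]|[]]|[]] //].
      by have [?|?] := pselect ((A2 `|` A5) t); [left|right].
    have := prU P mU mD; rewrite -AU U25 setDIK pr0 => D0.
    have := prU P mD mI; rewrite I25.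
    have := pr_ge0 P ((A `\` (A2 `|` A5)) `&` (A2 `&` A5)).
    have := pr_ge0 P ((A `\` (A2 `|` A5)) `|` (A2 `&` A5)).
    by rewrite subr0 in D0; lra.
  move=> t; rewrite not_implyP => -[At].
  rewrite /A2 /A5 /=.
  case e2: (edge2 \in X n t); case e5 : (edge5 \in X n t) => //= _.
  - by right; split; split.
  - by left; split => // -[[_]|[_]] /=; rewrite ?e2 ?e5.
apply: filterS (ae_forall_count good) => t H n; have := H (hist X n t).
by rewrite size_hist; apply; rewrite /cyl /= size_hist.
Qed.

Lemma trace14 : {ae P, forall t, forall n,
  (edge1 \in X n t) || (edge4 \in X n t)}.
Proof.
have good h : {ae P, forall t,
    cyl X h t -> (edge1 \in X (size h) t) || (edge4 \in X (size h) t)}.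
  pose A := cyl X h; pose n := size h.
  pose B := A `&` [set t | exists2 e, (e == edge1) || (e == edge4) & e \in X n t].
  have BE : B = A `&` ([set t | edge1 \in X n t] `|` [set t | edge4 \in X n t]).
    congr (_ `&` _); rewrite predeqE => t.
    split => [[e /orP[/eqP->|/eqP->]]|[e2|e5]].
    - by left.
    - by right.
    - by exists edge1.
    - by exists edge4.
  have mB : measurable B.
    by rewrite BE; apply: measurableI (mcyl h) _; apply: measurableU; exact: mXe.
  have mD : measurable (A `\` B) by exact: measurableD (mcyl h) mB.
  have prB : pr P B = pr P A.
    exact: (trace14_prob hwalk (mcyl h) (@past_cyl h) (@cyl_weight h) (weight_of_gt0 h)).
  apply: (ae_pr0 mD).
    have AU : A = B `|` (A `\` B).
      rewrite predeqE => t; split => [At|[[]|[]] //].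
      by have [?|?] := pselect (B t); [left|right].
    have := prU P mB mD; rewrite -AU prB setDIK pr0; lra.
  move=> t; rewrite not_implyP => -[At e14]; split => //.
  rewrite BE => -[_ [] /= e]; apply: e14; rewrite /n in e; by rewrite e ?orbT.
apply: filterS (ae_forall_count good) => t H n; have := H (hist X n t).
by rewrite size_hist; apply; rewrite /cyl /= size_hist.
Qed.

End AlmostSure.

(** * Sequences driven by a drift *)

Section Driven.
Context (R : realType).
Implicit Types (u v g h : R^nat).

(** Up to a convergent sequence, which absorbs the noise, [u] is an Euler scheme with drift [g] and
    steps [1 / (k + 2)]. *)
Definition driven u g : Prop :=
  cvgn (fun n => u n - \sum_(k < n) g k / k.+2%:R).

Lemma driven_sub u v g h : driven u g -> driven v h ->
  driven (fun n => u n - v n) (fun n => g n - h n).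
Proof.
move=> du dv; rewrite /driven (_ : (fun n => _) = (fun n =>
  (u n - \sum_(k < n) g k / k.+2%:R) - (v n - \sum_(k < n) h k / k.+2%:R))).
  exact: is_cvgB du dv.
apply/funext => n.
rewrite (eq_bigr (fun k : 'I_n => g k / k.+2%:R - h k / k.+2%:R)); last first.
  by move=> k _; rewrite mulrBl.
by rewrite sumrB; ring.
Qed.

Lemma driven_opp u g : driven u g -> driven (fun n => - u n) (fun n => - g n).
Proof.
move=> du; rewrite /driven (_ : (fun n => _) = (fun n =>
  - (u n - \sum_(k < n) g k / k.+2%:R))); first exact: is_cvgN du.
apply/funext => n; rewrite (eq_bigr (fun k : 'I_n => - (g k / k.+2%:R))); last first.
  by move=> k _; rewrite mulNr.
by rewrite sumrN; ring.
Qed.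

Lemma harmonic_sum_unbounded (M : R) : exists n, M < \sum_(k < n) k.+2%:R^-1.
Proof.
apply: contrapT => /forallNP bounded; apply: (@dvg_harmonic R).
apply: nondecreasing_is_cvgn.
  by apply/nondecreasing_seqP => n; rewrite !seriesEord /= big_ord_recr /= lerDl.
exists (1 + Num.max M 0) => _ [[|n] _ <-]; rewrite seriesEord /=.
  by rewrite big_ord0 addr_ge0 // le_max lexx orbT.
rewrite big_ord_recl /= invr1 lerD2l le_max; apply/orP; left.
by rewrite leNgt; apply/negP => Mn; exact: (bounded n).
Qed.

(** Replacing the convergent error by its limit gives [v], which moves exactly by [g n / (n + 2)]
    and is eventually within [eps] of [u]. Divergence of the harmonic series brings [v] below
    [b + 2 * eps]; upward steps of at most [eps], and descent above [b + eps], keep it there. *)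
Lemma driven_upper u g (C b delta b' : R) : driven u g ->
  (\forall n \near \oo, g n <= C) -> 0 < delta ->
  (\forall n \near \oo, b <= u n -> g n <= - delta) -> b < b' ->
  \forall n \near \oo, u n <= b'.
Proof.
move=> du gC delta0 gb bb'.
have [eps eps0 eps4] : exists2 eps : R, 0 < eps & 4 * eps = b' - b.
  by exists ((b' - b) / 4); [rewrite divr_gt0 ?subr_gt0|field].
pose c n := u n - \sum_(k < n) g k / k.+2%:R.
pose v n := \sum_(k < n) g k / k.+2%:R + limn c.
have vS n : v n.+1 = v n + g n / n.+2%:R.
  by rewrite /v big_ord_recr /= addrAC.
have uv : \forall n \near \oo, `|u n - v n| <= eps.
  have /cvgrPdist_le /(_ _ eps0) : c @ \oo --> limn c by [].
  apply: filterS => n; rewrite distrC /c /v; congr (`|_| <= _); ring.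
have gsmall : \forall n \near \oo, g n / n.+2%:R <= eps.
  have : \forall n \near \oo, C / eps <= n%:R.
    exact: nbhs_infty_ger.
  move=> H; near=> n; rewrite ler_pdivrMr ?ltr0n //.
  apply: (@le_trans _ _ C); first by near: n.
  rewrite mulrC -ler_pdivrMr //; apply: (@le_trans _ _ n%:R); first by near: n.
  by rewrite ler_nat -addn2 leq_addr.
have [N _ HN] : \forall n \near \oo, `|u n - v n| <= eps /\
    (b <= u n -> g n <= - delta) /\ g n / n.+2%:R <= eps.
  by near=> n; split; [near: n|split; near: n].
have down n : (N <= n)%N -> b + eps <= v n -> v n.+1 <= v n - delta / n.+2%:R.
  move=> /HN /= [] /ler_normlP[uv1 uv2] [gn _] bv.
  rewrite vS lerD2l -mulNr ler_pM2r ?invr_gt0 ?ltr0n // gn //; lra.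
have stays n : (N <= n)%N -> v n <= b + 2 * eps -> v n.+1 <= b + 2 * eps.
  move=> Nn vn; have [bv|vb] := leP (b + eps) (v n).
    apply: le_trans (down n Nn bv) _; apply: le_trans vn.
    by rewrite gerBl divr_ge0 // ltW.
  by have /= [_ [_ gn]] := HN n Nn; rewrite vS (le_trans (lerD (ltW vb) gn)) //; lra.
have [m Nm vm] : exists2 m, (N <= m)%N & v m <= b + 2 * eps.
  apply: contrapT => nex.
  have large n : (N <= n)%N -> b + 2 * eps < v n.
    by move=> Nn; rewrite ltNge; apply/negP => vn; apply: nex; exists n.
  pose S n : R := \sum_(k < n) k.+2%:R^-1.
  have SS n : S n.+1 = S n + n.+2%:R^-1 by rewrite /S big_ord_recr.
  have decr j : v (N + j)%N + delta * S (N + j)%N <= v N + delta * S N.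
    elim: j => [|j IH]; first by rewrite addn0.
    rewrite addnS SS mulrDr; apply: le_trans IH.
    have bv : b + eps <= v (N + j)%N.
      by have := large (N + j)%N (leq_addr _ _); lra.
    by have := down _ (leq_addr _ _) bv; set q := delta / _; lra.
  have [n Mn] := harmonic_sum_unbounded ((v N - b + delta * S N) / delta).
  have Sle : S n <= S (N + n)%N.
    rewrite addnC; elim: (N) => [|k IH]; first by rewrite addn0.
    by rewrite addnS SS (le_trans IH) // lerDl.
  have := decr n; have := large (N + n)%N (leq_addr _ _).
  move: Mn; rewrite -/(S n) ltr_pdivrMr // => Mn.
  have : S n * delta <= S (N + n)%N * delta by rewrite ler_pM2r.
  by lra.
have final j : v (m + j)%N <= b + 2 * eps.
  elim: j => [|j IH]; first by rewrite addn0.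
  by rewrite addnS stays // (leq_trans Nm) // leq_addr.
exists m => // n /= mn.
have /= [/ler_normlP[_ uvn] _] := HN n (leq_trans Nm mn).
have := final (n - m)%N; rewrite subnKC //; lra.
Unshelve. all: by end_near. Qed.

Lemma ln_driven_upper u g (C b delta b' : R) : (forall n, 0 < u n) ->
  driven (fun n => ln (u n)) g -> (\forall n \near \oo, g n <= C) ->
  0 < b -> 0 < delta ->
  (\forall n \near \oo, b <= u n -> g n <= - delta) -> b < b' ->
  \forall n \near \oo, u n <= b'.
Proof.
move=> u0 du gC b0 delta0 gb bb'.
have b'0 := lt_trans b0 bb'.
have := @driven_upper _ _ C (ln b) delta (ln b') du gC delta0.
rewrite ltr_ln ?posrE // => /(_ _ bb') H.
have {}H : \forall n \near \oo, ln (u n) <= ln b'.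
  apply: H; apply: filterS gb => n gn; rewrite ler_ln ?posrE //.
by apply: filterS H => n; rewrite ler_ln ?posrE.
Qed.

Lemma ln_driven_lower u g (C b delta b' : R) : (forall n, 0 < u n) ->
  driven (fun n => ln (u n)) g -> (\forall n \near \oo, - C <= g n) ->
  0 < b' -> 0 < delta ->
  (\forall n \near \oo, u n <= b -> delta <= g n) -> b' < b ->
  \forall n \near \oo, b' <= u n.
Proof.
move=> u0 du gC b'0 delta0 gb bb'.
have b0 := lt_trans b'0 bb'.
have gC' : \forall n \near \oo, - g n <= C.
  by apply: filterS gC => n; rewrite lerNl.
have := @driven_upper _ _ C (- ln b) delta (- ln b') (driven_opp du) gC' delta0.
rewrite ltrN2 ltr_ln ?posrE // => /(_ _ bb') H.
have {}H : \forall n \near \oo, - ln (u n) <= - ln b'.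
  apply: H; apply: filterS gb => n gn; rewrite lerN2 ler_ln ?posrE // lerN2.
  exact: gn.
by apply: filterS H => n; rewrite lerN2 ler_ln ?posrE.
Qed.

(** When the counter moves, the sequence changes by [ln (1 + 1 / W) - 1 / W], which lies between
    [1 / (W + 1) - 1 / W] and 0. It is thus nonincreasing, and the lower bounds telescope along the
    values of the counter. *)
Lemma ln_counter_cvg (W : nat -> nat) (b : nat -> bool) :
  (0 < W 0)%N -> (forall n, W n.+1 = W n + b n)%N ->
  cvgn (fun n => ln (W n)%:R - \sum_(k < n) (b k)%:R / (W k)%:R : R).
Proof.
move=> W0 WS; have Wgt0 n : (0 < W n)%N by elim: n => // n IH; rewrite WS addn_gt0 IH.
have Wpos n : 0 < (W n)%:R :> R by rewrite ltr0n.
set e := fun n => _.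
have eS n : e n.+1 = e n + (if b n then ln (1 + (W n)%:R^-1) - (W n)%:R^-1 else 0).
  rewrite /e big_ord_recr /= WS; case: (b n) => /=; last by rewrite addn0 mul0r !addr0.
  rewrite natrD (_ : (W n)%:R + 1 = (W n)%:R * (1 + (W n)%:R^-1)); last first.
    by rewrite mulrDr mulr1 divff // lt0r_neq0.
  rewrite lnM ?posrE // ?addr_gt0 ?invr_gt0 // mul1r; ring.
have step n : (W n).+1%:R^-1 - (W n)%:R^-1 <=
    ln (1 + (W n)%:R^-1) - (W n)%:R^-1 :> R /\
    ln (1 + (W n)%:R^-1) - (W n)%:R^-1 <= 0 :> R.
  rewrite subr_le0 lerD2r; split; last first.
    by rewrite le_ln1Dx // (lt_trans (ltrN10 _)) // invr_gt0.
  (* The lower bound is [ln (1 + y) <= y] at [y = - 1 / (W + 1)]. *)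
  rewrite [X in ln X](_ : _ = (1 - (W n).+1%:R^-1)^-1); last first.
    rewrite -natr1; field.
    by rewrite ?addrK ?natr1 !pnatr_eq0 -!lt0n ?Wgt0.
  have p : 0 < 1 - (W n).+1%:R^-1 :> R.
    by rewrite subr_gt0 invf_lt1 ?ltr0n // ltr1n ltnS.
  rewrite lnV ?posrE //=.
  rewrite lerNr le_ln1Dx // ltrN2 invf_lt1 ?ltr0n //.
  by rewrite ltr1n ltnS.
move: e eS => e eS.
apply: (@nonincreasing_is_cvgn R e).
  apply/nonincreasing_seqP => n; rewrite eS gerDl; case: (b n) => //.
  by case: (step n).
exists (e 0%N - (W 0)%:R^-1) => _ [n _ <-].
suff lo k : e 0%N - (W 0)%:R^-1 <= e k - (W k)%:R^-1.
  by apply: le_trans (lo n) _; rewrite gerBl.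
elim: k => // k IH; apply: le_trans IH _; rewrite eS WS.
case: (b k); last by rewrite addn0 addr0.
have [h _] := step k; rewrite addn1 /= -addrA lerD2l lerBrDl.
by apply: le_trans h; rewrite addrC.
Qed.

End Driven.

(** * Drift inequalities *)

Ltac nneg := rewrite ?(addr_ge0, mulr_ge0, sqr_ge0) // ltW.

Section RateBounds.
Context (R : realType).

Definition lozenge_state (x1 x2 x3 x4 x5 : R) : Prop :=
  [/\ 0 < x1 <= 1, 0 < x2 <= 1, 0 < x3 <= 1, 0 < x4 <= 1 & 0 < x5 <= 1] /\
  x2 + x5 = 1 /\ 1 <= x1 + x4.

Lemma lozenge_state_swap (x1 x2 x3 x4 x5 : R) :
  lozenge_state x1 x2 x3 x4 x5 -> lozenge_state x4 x5 x3 x1 x2.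
Proof. by move=> [[? ? ? ? ?] [? ?]]; rewrite /lozenge_state [x5 + _]addrC [x4 + _]addrC. Qed.

(** [x1 * rate1] is a crossing probability. The positive term in the proof is the excess of the
    denominator over [x1] times the numerator. *)
Lemma rate1_le (x1 x2 x3 x4 x5 : R) : lozenge_state x1 x2 x3 x4 x5 ->
  rate1 x1 x2 x3 x4 x5 <= x1^-1.
Proof.
move=> [[/andP[p1 _] /andP[p2 _] /andP[p3 _] /andP[p4 _] /andP[p5 _]] _].
rewrite /rate1 ler_pdivrMr ?(addr_gt0, mulr_gt0) // [leRHS]mulrC ler_pdivlMr //.
have : 0 < x4 * (x5 * (x1 + x2 + x3) + x3 * x2) by rewrite ?(addr_gt0, mulr_gt0).
by lra.
Qed.

Lemma rate2_le (x1 x2 x3 x4 x5 : R) : lozenge_state x1 x2 x3 x4 x5 ->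
  rate2 x1 x2 x3 x4 x5 <= x2^-1.
Proof.
move=> [[/andP[p1 _] /andP[p2 _] /andP[p3 _] /andP[p4 _] /andP[p5 _]] _].
rewrite /rate2 ler_pdivrMr ?(addr_gt0, mulr_gt0) // [leRHS]mulrC ler_pdivlMr //.
have : 0 < (x3 * (x1 + x4) + x1 * x4) * x5 by rewrite ?(addr_gt0, mulr_gt0).
have : 0 < x4 * x2 * x5 by rewrite ?(addr_gt0, mulr_gt0).
by lra.
Qed.

(** Repulsion from 0: a small [x1] forces [x4] to be at least 9/10, because [x1 + x4 >= 1]. *)
Lemma rate1_small (x1 x2 x3 x4 x5 : R) : lozenge_state x1 x2 x3 x4 x5 ->
  x1 <= 1 / 10 -> 1 + 1 / 10 <= rate1 x1 x2 x3 x4 x5.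
Proof.
move=> [[/andP[p1 _] /andP[p2 _] /andP[p3 _] /andP[p4 q4] /andP[p5 _]] [e25 s1]] h1.
rewrite /rate1 ler_pdivlMr ?(addr_gt0, mulr_gt0) //.
have {e25} e2 : x2 = 1 - x5 by lra.
subst x2; set S := x1 + (1 - x5) + x3.
have S0 : 0 <= S by rewrite /S; lra.
have hS : (x1 + x4) * (x5 * S) <= (1 + 1 / 10) * (x5 * S).
  by rewrite ler_wpM2r ?mulr_ge0 ?(ltW p5) //; lra.
have h3 : (x1 + x4) * (x3 * (x1 + (1 - x5))) <= (1 + 1 / 10) * (x3 * (x1 + (1 - x5))).
  by rewrite ler_wpM2r ?mulr_ge0 ?(ltW p3) //; lra.
have h13 : x3 * x1 <= x3 * (1 / 10) by rewrite ler_wpM2l ?(ltW p3).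
have h4 : x1 * x4 * S <= (1 / 10) * S.
  rewrite ler_wpM2r //; apply: (@le_trans _ _ (x1 * 1)); last by lra.
  by rewrite ler_wpM2l ?(ltW p1).
have h5 : (1 - 1 / 10) * S <= x4 * S by rewrite ler_wpM2r //; lra.
have h6 : x3 * 1 <= x3 * (x1 + x4) by rewrite ler_wpM2l ?(ltW p3).
have h7 : x5 * S <= 1 * S by rewrite ler_wpM2r //; lra.
have h8 : 0 <= x3 * (1 - x5) by rewrite mulr_ge0 ?(ltW p3) // ltW.
have h9 : 0 <= x3 * x5 by rewrite mulr_ge0 ?(ltW p3) // ltW.
by clearbody S; lra.
Qed.

Lemma rate2_small (x1 x2 x3 x4 x5 : R) : lozenge_state x1 x2 x3 x4 x5 ->
  1 / 20 <= x1 -> x2 <= 1 / 100 -> 1 + 1 / 200 <= rate2 x1 x2 x3 x4 x5.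
Proof.
move=> [[/andP[p1 q1] /andP[p2 _] /andP[p3 q3] /andP[p4 q4] /andP[p5 q5]] [e25 s1]] h1 h2.
rewrite /rate2 ler_pdivlMr ?(addr_gt0, mulr_gt0) //.
rewrite e25 mulr1.
have : (x1 + x4) * x2 * x5 <= 2 * (1 / 100) * 1.
  by rewrite !ler_pM ?mulr_ge0 ?addr_ge0 ?(ltW p1) ?(ltW p2) ?(ltW p4) ?(ltW p5) //; lra.
have : 1 / 20 * (99 / 100) <= x1 * x5 by rewrite ler_pM //; lra.
have : x3 * (x1 + x4) <= 1 * 2 by rewrite ler_pM ?addr_ge0 ?(ltW p3) ?(ltW p1) ?(ltW p4) //; lra.
have : x1 * x4 <= 1 * 1 by rewrite ler_pM ?(ltW p1) ?(ltW p4).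
by lra.
Qed.

(** As [x2 + x5 = 1], both rates have the same denominator. The numerator has the sign of
    [x1 / (x1 + x4) - x2], so [x2] is drawn towards that ratio. *)
Lemma rate2_diff (x1 x2 x3 x4 x5 : R) : lozenge_state x1 x2 x3 x4 x5 ->
  rate2 x1 x2 x3 x4 x5 - rate2 x4 x5 x3 x1 x2 =
  (x1 - (x1 + x4) * x2) / ((x1 + x4) * x2 * x5 + (x3 * (x1 + x4) + x1 * x4)).
Proof.
move=> [[/andP[p1 _] /andP[p2 _] /andP[p3 _] /andP[p4 _] /andP[p5 _]] [e25 _]].
have e2 : x2 = 1 - x5 by lra.
rewrite /rate2 [x5 + x2]addrC e25 !mulr1.
rewrite [(x4 + x1) * x5 * x2 + _](_ : _ =
  (x1 + x4) * x2 * x5 + (x3 * (x1 + x4) + x1 * x4)); last by ring.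
by rewrite -mulrBl; congr (_ / _); rewrite e2; ring.
Qed.

(* With [x1 = s a] and [x4 = s b], the numerator of the difference of the growth
   rates of edges 4 and 1 is [s ^+ 2] times the left member, a polynomial of
   degree 2 in the weight [c] of edge 3 whose coefficients are nonnegative. *)
Lemma rate_gap_poly (s a b y z c : R) : a + b = 1 -> y + z = 1 ->
  1 <= s -> 0 < b -> b <= a -> 0 < y -> 0 < z -> 0 <= c ->
  b ^+ 2 * y <= a ^+ 2 * z -> 2 * b - a <= y ->
  (s * a + y) * (s * b + z) * (s * a * b) * (a - b) <=
  a * (a * (s * b + z) + c * (1 + a)) *
    ((z + s * a * b) * (s * a + y) + c * (1 + s * a * (1 + b))) -
  b * (b * (s * a + y) + c * (1 + b)) *
    ((y + s * a * b) * (s * b + z) + c * (1 + s * b * (1 + a))).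
Proof.
move=> ab yz s1 b0 ba y0 z0 c0 u0 v0.
have s0 : 0 < s by lra.
have a0 : 0 < a by lra.
have Eb : b = 1 - a by lra.
have Ez : z = 1 - y by lra.
pose H := s * a * b; pose P := s * a + y; pose Q := s * b + z.
have H0 : 0 < H by rewrite !mulr_gt0.
have P0 : 0 < P by rewrite addr_gt0 ?mulr_gt0.
have Q0 : 0 < Q by rewrite addr_gt0 ?mulr_gt0.
have ab0 : 0 <= a - b by lra.
(* [c2] is the coefficient of [c ^+ 2]; [c11], [c12'] and [c13'] build the coefficient of [c]; [c00]
   is the constant term. *)
have c2 : 0 <= a * (1 + a) * (1 + s * a * (1 + b)) - b * (1 + b) * (1 + s * b * (1 + a)).
  rewrite subr_ge0; apply: ler_pM; first by nneg.
  - by nneg.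
  - by apply: ler_pM => //; [nneg|nneg|rewrite lerD2l].
  - by rewrite lerD2l -!mulrA ler_wpM2l ?(ltW s0) //; lra.
have aQ : b ^+ 2 * P <= a ^+ 2 * Q.
  rewrite -subr_ge0 (_ : _ - _ = H * (a - b) + (a ^+ 2 * z - b ^+ 2 * y)); last first.
    by rewrite /P /Q /H; ring.
  apply: addr_ge0; last by rewrite subr_ge0.
  by rewrite mulr_ge0 // ltW.
have c11 : 0 <= a ^+ 2 * Q * (1 + s * a * (1 + b)) - b ^+ 2 * P * (1 + s * b * (1 + a)).
  rewrite subr_ge0; apply: ler_pM => //; first by nneg.
  - by nneg.
  - by rewrite lerD2l -!mulrA ler_wpM2l ?(ltW s0) //; lra.
have c12 : 0 <= a * z * P - b * y * Q.
  rewrite (_ : _ - _ = s * (a ^+ 2 * z - b ^+ 2 * y) + (a - b) * (y * z)); last first.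
    by rewrite /P /Q; ring.
  apply: addr_ge0; apply: mulr_ge0 => //; [exact: ltW|by rewrite subr_ge0|].
  by rewrite mulr_ge0 // ltW.
have c13 : 0 <= a * P - b * Q.
  rewrite (_ : _ - _ = (s - 1) * (a - b) + (y - (2 * b - a))); last first.
    by rewrite /P /Q Eb Ez; ring.
  apply: addr_ge0; last by rewrite subr_ge0.
  by rewrite mulr_ge0 // subr_ge0.
have up (e f : R) : 0 <= f -> 0 <= e - f -> 0 <= (1 + a) * e - (1 + b) * f.
  move=> f0 ef; rewrite (_ : _ - _ = (1 + a) * (e - f) + (a - b) * f); last by ring.
  by apply: addr_ge0; apply: mulr_ge0 => //; lra.
have c12' := up _ _ (mulr_ge0 (mulr_ge0 (ltW b0) (ltW y0)) (ltW Q0)) c12.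
have c13' := up _ _ (mulr_ge0 (ltW b0) (ltW Q0)) c13.
have c00 : 0 <= P * Q * (a ^+ 2 * z - b ^+ 2 * y).
  by rewrite mulr_ge0 ?subr_ge0 // mulr_ge0 // ltW.
rewrite -subr_ge0.
rewrite [leRHS](_ : _ = P * Q * (a ^+ 2 * z - b ^+ 2 * y) + c ^+ 2 *
   (a * (1 + a) * (1 + s * a * (1 + b)) - b * (1 + b) * (1 + s * b * (1 + a))) +
   c * ((a ^+ 2 * Q * (1 + s * a * (1 + b)) - b ^+ 2 * P * (1 + s * b * (1 + a))) +
     ((1 + a) * (a * z * P) - (1 + b) * (b * y * Q)) +
     H * ((1 + a) * (a * P) - (1 + b) * (b * Q)))).
  apply: addr_ge0; first by apply: addr_ge0 => //; exact: mulr_ge0 (sqr_ge0 _) c2.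
  apply: mulr_ge0 => //; apply: addr_ge0; first exact: addr_ge0 c11 c12'.
  by apply: mulr_ge0 => //; exact: ltW.
by rewrite /P /Q /H Eb; ring.
Qed.

Let den (s a b y z c : R) := (z + s * a * b) * (s * a + y) + c * (1 + s * a * (1 + b)).

(** Separates the term [s^-1], which is common to edges 1 and 4 and cancels in the difference of
    their rates. *)
Let rate1_polar (s a b y z c : R) : a + b = 1 -> y + z = 1 ->
  0 < s -> 0 < a -> 0 < b -> 0 < y -> 0 < z -> 0 < c ->
  rate1 (s * a) y c (s * b) z =
  s^-1 + b * (b * (s * a + y) + c * (1 + b)) / den s a b y z c.
Proof.
move=> ab yz s0 a0 b0 y0 z0 c0.
have Eb : b = 1 - a by lra.
have Ez : z = 1 - y by lra.
have D0 : den s a b y z c != 0.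
  by rewrite lt0r_neq0 // /den ?(addr_gt0, mulr_gt0).
rewrite /rate1 [X in _ / X](_ : _ = s * den s a b y z c); last first.
  by rewrite /den Eb Ez; ring.
rewrite [X in X / _](_ : _ = den s a b y z c +
    s * (b * (b * (s * a + y) + c * (1 + b)))); last first.
  by rewrite /den Eb Ez; ring.
by field; rewrite D0 lt0r_neq0.
Qed.

(** [rate_gap_poly] divided by the two denominators. Its left member is at least [t / 20 ^+ 4], and
    each denominator is at most 7, with [7 * 7 <= 20 ^+ 2]. *)
Lemma rate_gap (x1 x2 x3 x4 x5 t : R) : lozenge_state x1 x2 x3 x4 x5 ->
  1 / 20 <= x1 -> 1 / 20 <= x4 -> 0 < t -> t <= x1 / (x1 + x4) - 1 / 2 ->
  `|x2 - 1 / 2| <= 21 / 20 * (x1 / (x1 + x4) - 1 / 2) ->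
  rate1 x1 x2 x3 x4 x5 - rate1 x4 x5 x3 x1 x2 <= - (t / 20 ^+ 6).
Proof.
move=> [[/andP[p1 q1] /andP[p2 q2] /andP[p3 q3] /andP[p4 q4] /andP[p5 q5]] [e25 s1]].
move=> h1 h4 t0.
have [s Es] : exists s, s = x1 + x4 by exists (x1 + x4).
have [a Ea] : exists a, a = x1 / s by exists (x1 / s).
have [b Eb] : exists b, b = x4 / s by exists (x4 / s).
have s0 : 0 < s by lra.
have X1 : x1 = s * a by rewrite Ea; field; rewrite lt0r_neq0.
have X4 : x4 = s * b by rewrite Eb; field; rewrite lt0r_neq0.
rewrite -Es -Ea => ht /ler_normlP[lo hi].
have a0 : 0 < a by rewrite Ea divr_gt0.
have b0 : 0 < b by rewrite Eb divr_gt0.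
have ab : a + b = 1 by rewrite Ea Eb -mulrDl -Es divff // lt0r_neq0.
have b40 : 1 / 40 <= b.
  by rewrite Eb ler_pdivlMr //; lra.
(* With [a = 1 / 2 + r] this reads [x2 * (1 / 2 + 2 * r ^+ 2) <= a ^+ 2]. For
   [x2 <= 1 / 2 + 21 / 20 * r] it follows from [21 / 10 * r ^+ 2 <= 19 / 40], which [r <= 19 / 40]
   barely allows. *)
have u0 : b ^+ 2 * x2 <= a ^+ 2 * x5.
  have -> : x5 = 1 - x2 by lra.
  have [r [r0 r1 ar]] : exists r, [/\ 0 <= r, r <= 19 / 40 & a = 1 / 2 + r].
    by exists (a - 1 / 2); split; lra.
  have -> : b = 1 / 2 - r by lra.
  rewrite ar; rewrite ar in lo hi.
  have r2 : r ^+ 2 <= (19 / 40) ^+ 2 by rewrite lerXn2r ?nnegrE //; lra.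
  have r3 : r * r ^+ 2 <= r * (19 / 40) ^+ 2 by rewrite ler_wpM2l.
  have : x2 * (1 / 2 + 2 * r ^+ 2) <= (1 / 2 + 21 / 20 * r) * (1 / 2 + 2 * r ^+ 2).
    by rewrite ler_wpM2r ?addr_ge0 ?mulr_ge0 ?sqr_ge0 //; lra.
  by lra.
have v0 : 2 * b - a <= x2 by lra.
have s1' : 1 <= s by lra.
have ba : b <= a by lra.
have F := rate_gap_poly ab e25 s1' b0 ba p2 p5 (ltW p3) u0 v0.
rewrite X1 X4 rate1_polar // rate1_polar //; try by lra.
have D1 : 0 < den s a b x2 x5 x3 by rewrite /den ?(addr_gt0, mulr_gt0).
have D4 : 0 < den s b a x5 x2 x3 by rewrite /den ?(addr_gt0, mulr_gt0).
have H1 : s * a * b <= 1.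
  rewrite -X1; apply: (@le_trans _ _ (1 * 1)); last by rewrite mulr1.
  by rewrite ler_pM ?(ltW p1) ?(ltW b0) //; lra.
have den_le a' b' y z : 0 < a' -> 0 < b' -> 0 <= y <= 1 -> 0 <= z <= 1 -> b' <= 1 ->
    s * a' <= 1 -> s * a' * b' <= 1 -> den s a' b' y z x3 <= 7.
  move=> a'0 b'0 /andP[y0 y1] /andP[z0 z1] b'1 sa sab; rewrite /den.
  have sa0 : 0 <= s * a' by rewrite mulr_ge0 // ltW.
  have sab0 : 0 <= s * a' * b' by rewrite mulr_ge0 // ltW.
  have : (z + s * a' * b') * (s * a' + y) <= 2 * 2 by rewrite ler_pM //; lra.
  have sb : s * a' * (1 + b') <= 1 * 2 by rewrite ler_pM //; lra.
  have : x3 * (1 + s * a' * (1 + b')) <= 1 * 3.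
    rewrite ler_pM ?(ltW p3) //; last by lra.
    by rewrite addr_ge0 // mulr_ge0 // addr_ge0 // ltW.
  by lra.
have D1le : den s a b x2 x5 x3 <= 7.
  apply: den_le => //; [by rewrite (ltW p2)|by rewrite (ltW p5)|lra|by rewrite -X1].
have D4le : den s b a x5 x2 x3 <= 7.
  apply: den_le => //; [by rewrite (ltW p5)|by rewrite (ltW p2)|lra|by rewrite -X4|].
  by rewrite mulrAC.
have DD : den s a b x2 x5 x3 * den s b a x5 x2 x3 <= 7 * 7.
  by rewrite ler_pM ?(ltW D1) ?(ltW D4).
have low : t / 20 ^+ 4 <= (s * a + x2) * (s * b + x5) * (s * a * b) * (a - b).
  have sab : 1 / 20 * (1 / 40) <= s * a * b by rewrite ler_pM //; lra.
  have PQ : 1 / 20 * (1 / 20) <= (s * a + x2) * (s * b + x5) by rewrite ler_pM //; lra.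
  have PQH : 1 / 20 * (1 / 20) * (1 / 20 * (1 / 40)) <=
      (s * a + x2) * (s * b + x5) * (s * a * b) by rewrite ler_pM //; lra.
  have : 1 / 20 * (1 / 20) * (1 / 20 * (1 / 40)) * (2 * t) <=
      (s * a + x2) * (s * b + x5) * (s * a * b) * (a - b).
    by rewrite ler_pM //; lra.
  by lra.
rewrite [leLHS](_ : _ = - ((a * (a * (s * b + x5) + x3 * (1 + a)) * den s a b x2 x5 x3 -
    b * (b * (s * a + x2) + x3 * (1 + b)) * den s b a x5 x2 x3) /
    (den s a b x2 x5 x3 * den s b a x5 x2 x3))); last first.
  by field; rewrite !lt0r_neq0.
rewrite lerN2 ler_pdivlMr ?mulr_gt0 //.
have F' : t / 20 ^+ 4 <= a * (a * (s * b + x5) + x3 * (1 + a)) * den s a b x2 x5 x3 -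
    b * (b * (s * a + x2) + x3 * (1 + b)) * den s b a x5 x2 x3.
  apply: le_trans low (le_trans F _).
  by rewrite /den (mulrAC s b a).
apply: le_trans F'.
have : t / 20 ^+ 6 * (den s a b x2 x5 x3 * den s b a x5 x2 x3) <= t / 20 ^+ 6 * (7 * 7).
  by rewrite ler_wpM2l // divr_ge0 ?exprn_ge0 ?(ltW t0).
by lra.
Qed.

End RateBounds.

(** * The drift of edge 3 and the limiting cubic of edge 1 *)

Section RateLimits.
Context (R : realType).

(** [rate3] is the inverse of a weighted mean of [x3 + x2] and [x3 + x5], with weights [A] and
    [B]. *)
Lemma rate3_bounds (x1 x2 x3 x4 x5 m M : R) : lozenge_state x1 x2 x3 x4 x5 ->
  0 <= m -> m <= x2 <= M -> m <= x5 <= M ->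
  (x3 + M)^-1 <= rate3 x1 x2 x3 x4 x5 <= (x3 + m)^-1.
Proof.
move=> [[/andP[p1 _] /andP[p2 _] /andP[p3 _] /andP[p4 _] /andP[p5 _]] _].
move=> m0 /andP[m2 M2] /andP[m5 M5].
rewrite /rate3; set A := x1 * _; set B := x4 * _.
have A0 : 0 < A by rewrite /A ?(addr_gt0, mulr_gt0).
have B0 : 0 < B by rewrite /B ?(addr_gt0, mulr_gt0).
have D0 : 0 < A * (x2 + x3) + B * (x3 + x5) by rewrite ?(addr_gt0, mulr_gt0).
apply/andP; split.
  rewrite ler_pdivlMr // mulrC ler_pdivrMr; last by lra.
  have : A * x2 <= A * M by rewrite ler_wpM2l // ltW.
  have : B * x5 <= B * M by rewrite ler_wpM2l // ltW.
  by clearbody A B; lra.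
rewrite ler_pdivrMr // [leRHS]mulrC ler_pdivlMr; last by lra.
have : A * m <= A * x2 by rewrite ler_wpM2l // ltW.
have : B * m <= B * x5 by rewrite ler_wpM2l // ltW.
by clearbody A B; lra.
Qed.

(** When [x1 = x4 = x] and the other weights are 1/2, the numerator of [rate1] minus its denominator
    is minus half of this cubic. *)
Definition limit_cubic (x : R) : R := 2 * x ^+ 3 + 4 * x ^+ 2 - 2 * x - 3 / 2.

(** The cofactor of [x - w] is at least [2 * w ^+ 2 + 4 * w - 2], which equals [3 / (2 * w)] at a
    root, and [w <= 1]. This yields both uniqueness of the root and a quantitative sign. *)
Lemma limit_cubic_root (w x : R) : 0 < w -> limit_cubic w = 0 -> 0 < x ->
  exists2 c, 3 / 2 <= c & limit_cubic x = (x - w) * c.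
Proof.
move=> w0 Gw x0; exists (2 * (x ^+ 2 + x * w + w ^+ 2) + 4 * (x + w) - 2); last first.
  by rewrite -[LHS]subr0 -Gw /limit_cubic; ring.
have c0 : 0 < 2 * w ^+ 2 + 4 * w - 2.
  have : 0 < w * (2 * w ^+ 2 + 4 * w - 2) by move: Gw; rewrite /limit_cubic; lra.
  by rewrite pmulr_rgt0.
have w1 : w <= 1.
  rewrite leNgt; apply/negP => w1.
  have : w * 1 <= w * w by rewrite ler_wpM2l // ltW.
  have : w ^+ 2 * 1 <= w ^+ 2 * w by rewrite ler_wpM2l ?sqr_ge0 // ltW.
  by move: Gw; rewrite /limit_cubic; lra.
have c1 : 3 / 2 <= 2 * w ^+ 2 + 4 * w - 2.
  have : w * (2 * w ^+ 2 + 4 * w - 2) <= 1 * (2 * w ^+ 2 + 4 * w - 2).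
    by rewrite ler_wpM2r // ltW.
  by move: Gw; rewrite /limit_cubic; lra.
have : 0 <= x * w by rewrite mulr_ge0 // ltW.
have := sqr_ge0 x; lra.
Qed.

Let num1 (x1 x2 x3 x4 x5 : R) := (x4 + x5) * (x1 + x2 + x3) + x3 * (x1 + x2 + x4).
Let den1 (x1 x2 x3 x4 x5 : R) :=
  (x1 + x4) * (x5 * (x1 + x2 + x3) + x3 * (x1 + x2)) + x1 * x4 * (x1 + x2 + x3).

Let prod01 (x y : R) : 0 <= x <= 1 -> 0 <= y <= 1 -> 0 <= x * y <= 1.
Proof.
move=> /andP[x0 x1] /andP[y0 y1]; rewrite mulr_ge0 //=.
by rewrite -(mulr1 1) ler_pM.
Qed.

(* [num1 - den1] is affine in each of [x2], [x3], [x4] and [x5]. *)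
Let drift1_error (x1 x2 x3 x4 x5 eta : R) : lozenge_state x1 x2 x3 x4 x5 ->
  `|x2 - 1 / 2| <= eta -> `|x3 - 1 / 2| <= eta -> `|x4 - x1| <= eta ->
  `|num1 x1 x2 x3 x4 x5 - den1 x1 x2 x3 x4 x5 + limit_cubic x1 / 2| <= 40 * eta.
Proof.
move=> [[/andP[p1 q1] /andP[p2 q2] /andP[p3 q3] /andP[p4 q4] /andP[p5 q5]] [e25 _]] h2 h3 h4.
(* [d2], ..., [d5] are the slopes met when [x2], [x3], [x4] and [x5] are moved in this order to 1/2,
   1/2, [x1] and 1/2. *)
pose d2 := x4 + x5 + x3 - (x1 + x4) * (x5 + x3) - x1 * x4.
pose d3 := x4 + x5 + (x1 + 1 / 2 + x4) - (x1 + x4) * (x5 + x1 + 1 / 2) - x1 * x4.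
pose d4 := x1 + 1 + 1 / 2 - (x5 * (x1 + 1) + 1 / 2 * (x1 + 1 / 2)) - x1 * (x1 + 1).
pose d5 := x1 + 1 - 2 * x1 * (x1 + 1).
have -> : num1 x1 x2 x3 x4 x5 - den1 x1 x2 x3 x4 x5 + limit_cubic x1 / 2 =
    (x2 - 1 / 2) * d2 + (x3 - 1 / 2) * d3 + (x4 - x1) * d4 + (1 / 2 - x2) * d5.
  have e5 : x5 = 1 - x2 by lra.
  by rewrite /num1 /den1 /d2 /d3 /d4 /d5 /limit_cubic e5; field.
have i1 : 0 <= x1 <= 1 by rewrite (ltW p1).
have i3 : 0 <= x3 <= 1 by rewrite (ltW p3).
have i4 : 0 <= x4 <= 1 by rewrite (ltW p4).
have i5 : 0 <= x5 <= 1 by rewrite (ltW p5).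
have /andP[a1 b1] := prod01 i1 i5. have /andP[a2 b2] := prod01 i1 i3.
have /andP[a3 b3] := prod01 i4 i5. have /andP[a4 b4] := prod01 i4 i3.
have /andP[a5 b5] := prod01 i1 i4. have /andP[a6 b6] := prod01 i1 i1.
have D2 : `|d2| <= 10 by rewrite ler_norml /d2; lra.
have D3 : `|d3| <= 10 by rewrite ler_norml /d3; lra.
have D4 : `|d4| <= 10 by rewrite ler_norml /d4; lra.
have D5 : `|d5| <= 10 by rewrite ler_norml /d5; lra.
have bnd (e D : R) : `|e| <= eta -> `|D| <= 10 -> `|e * D| <= eta * 10.
  by move=> he hD; rewrite normrM ler_pM.
have h2' : `|1 / 2 - x2| <= eta by rewrite distrC.
have := ler_normD ((x2 - 1 / 2) * d2 + (x3 - 1 / 2) * d3 + (x4 - x1) * d4) ((1 / 2 - x2) * d5).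
have := ler_normD ((x2 - 1 / 2) * d2 + (x3 - 1 / 2) * d3) ((x4 - x1) * d4).
have := ler_normD ((x2 - 1 / 2) * d2) ((x3 - 1 / 2) * d3).
have := bnd _ _ h2 D2. have := bnd _ _ h3 D3. have := bnd _ _ h4 D4. have := bnd _ _ h2' D5.
lra.
Qed.

(** Expanded, the denominator is a sum of 13 monomials, each at most 1. *)
Let den1_bounds (x1 x2 x3 x4 x5 : R) : lozenge_state x1 x2 x3 x4 x5 ->
  0 < den1 x1 x2 x3 x4 x5 <= 13.
Proof.
move=> [[/andP[p1 q1] /andP[p2 q2] /andP[p3 q3] /andP[p4 q4] /andP[p5 q5]] _].
apply/andP; split; first by rewrite /den1 ?(addr_gt0, mulr_gt0).
have i1 : 0 <= x1 <= 1 by rewrite (ltW p1).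
have i2 : 0 <= x2 <= 1 by rewrite (ltW p2).
have i3 : 0 <= x3 <= 1 by rewrite (ltW p3).
have i4 : 0 <= x4 <= 1 by rewrite (ltW p4).
have i5 : 0 <= x5 <= 1 by rewrite (ltW p5).
have up (x y z : R) : 0 <= x <= 1 -> 0 <= y <= 1 -> 0 <= z <= 1 -> x * y * z <= 1.
  by move=> hx hy hz; have /andP[] := prod01 (prod01 hx hy) hz.
have := up _ _ _ i1 i5 i1; have := up _ _ _ i1 i5 i2; have := up _ _ _ i1 i5 i3.
have := up _ _ _ i4 i5 i1; have := up _ _ _ i4 i5 i2; have := up _ _ _ i4 i5 i3.
have := up _ _ _ i1 i3 i1; have := up _ _ _ i1 i3 i2; have := up _ _ _ i4 i3 i1.
have := up _ _ _ i4 i3 i2; have := up _ _ _ i1 i4 i1; have := up _ _ _ i1 i4 i2.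
by have := up _ _ _ i1 i4 i3; rewrite /den1; lra.
Qed.

(** Half of the cubic is at least [3 / 4 * eps] and the error at most [2 / 5 * eps]; what remains,
    divided by 13, still exceeds [eps / 40]. *)
Lemma rate1_above (w x1 x2 x3 x4 x5 eps : R) : lozenge_state x1 x2 x3 x4 x5 ->
  0 < w -> limit_cubic w = 0 -> 0 < eps -> w + eps <= x1 ->
  `|x2 - 1 / 2| <= eps / 100 -> `|x3 - 1 / 2| <= eps / 100 -> `|x4 - x1| <= eps / 100 ->
  rate1 x1 x2 x3 x4 x5 - 1 <= - (eps / 40).
Proof.
move=> st w0 Gw eps0 wx h2 h3 h4.
have x10 : 0 < x1 by lra.
have [c c1 Gx] := limit_cubic_root w0 Gw x10.
have /ler_normlP[_] := drift1_error st h2 h3 h4.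
have /andP[D0 D13] := den1_bounds st.
rewrite Gx => up.
have -> : rate1 x1 x2 x3 x4 x5 = num1 x1 x2 x3 x4 x5 / den1 x1 x2 x3 x4 x5 by [].
rewrite lerBlDr ler_pdivrMr //.
have : eps * (3 / 2) <= (x1 - w) * c by rewrite ler_pM //; lra.
have : eps / 40 * den1 x1 x2 x3 x4 x5 <= eps / 40 * 13.
  by rewrite ler_wpM2l // divr_ge0 // ltW.
by move: up; move: (den1 _ _ _ _ _) (num1 _ _ _ _ _) => D N; lra.
Qed.

Lemma rate1_below (w x1 x2 x3 x4 x5 eps : R) : lozenge_state x1 x2 x3 x4 x5 ->
  0 < w -> limit_cubic w = 0 -> 0 < eps -> x1 <= w - eps ->
  `|x2 - 1 / 2| <= eps / 100 -> `|x3 - 1 / 2| <= eps / 100 -> `|x4 - x1| <= eps / 100 ->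
  eps / 40 <= rate1 x1 x2 x3 x4 x5 - 1.
Proof.
move=> st w0 Gw eps0 wx h2 h3 h4.
have x10 : 0 < x1 by case: st => -[/andP[]].
have [c c1 Gx] := limit_cubic_root w0 Gw x10.
have /ler_normlP[up _] := drift1_error st h2 h3 h4.
have /andP[D0 D13] := den1_bounds st.
rewrite Gx in up.
have -> : rate1 x1 x2 x3 x4 x5 = num1 x1 x2 x3 x4 x5 / den1 x1 x2 x3 x4 x5 by [].
rewrite lerBrDr ler_pdivlMr //.
have : eps * (3 / 2) <= (w - x1) * c by rewrite ler_pM //; lra.
have : eps / 40 * den1 x1 x2 x3 x4 x5 <= eps / 40 * 13.
  by rewrite ler_wpM2l // divr_ge0 // ltW.
by move: up; move: (den1 _ _ _ _ _) (num1 _ _ _ _ _) => D N; lra.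
Qed.

End RateLimits.

(** * Convergence of the normalized weights *)

Section Flow.
Context (R : realType).

(** All that is retained of a trajectory: the convergence of a flow is a deterministic statement. *)
Definition flow (x1 x2 x3 x4 x5 : R^nat) : Prop :=
  (forall n, lozenge_state (x1 n) (x2 n) (x3 n) (x4 n) (x5 n)) /\
  [/\ driven (fun n => ln (x1 n))
        (fun n => rate1 (x1 n) (x2 n) (x3 n) (x4 n) (x5 n) - 1),
      driven (fun n => ln (x2 n))
        (fun n => rate2 (x1 n) (x2 n) (x3 n) (x4 n) (x5 n) - 1),
      driven (fun n => ln (x3 n))
        (fun n => rate3 (x1 n) (x2 n) (x3 n) (x4 n) (x5 n) - 1),
      driven (fun n => ln (x4 n))
        (fun n => rate1 (x4 n) (x5 n) (x3 n) (x1 n) (x2 n) - 1) &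
      driven (fun n => ln (x5 n))
        (fun n => rate2 (x4 n) (x5 n) (x3 n) (x1 n) (x2 n) - 1)].

(** Reflection of the lozenge, which turns one-sided estimates into two-sided ones. *)
Lemma flow_swap x1 x2 x3 x4 x5 : flow x1 x2 x3 x4 x5 -> flow x4 x5 x3 x1 x2.
Proof.
move=> [st [d1 d2 d3 d4 d5]]; split; first by move=> n; exact: lozenge_state_swap.
split => //; rewrite (_ : (fun n => rate3 _ _ _ _ _ - 1) =
  (fun n => rate3 (x1 n) (x2 n) (x3 n) (x4 n) (x5 n) - 1)) //.
apply/funext => n; rewrite /rate3; congr (_ / _ - 1); ring.
Qed.

Section OneFlow.
Context (x1 x2 x3 x4 x5 : R^nat).
Hypothesis fl : flow x1 x2 x3 x4 x5.

Let st n : lozenge_state (x1 n) (x2 n) (x3 n) (x4 n) (x5 n).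
Proof. by case: fl. Qed.

Let x1_gt0 n : 0 < x1 n. Proof. by have [[/andP[]]] := st n. Qed.
Let x2_gt0 n : 0 < x2 n. Proof. by have [[_ /andP[]]] := st n. Qed.
Let x3_gt0 n : 0 < x3 n. Proof. by have [[_ _ /andP[]]] := st n. Qed.
Let x4_gt0 n : 0 < x4 n. Proof. by have [[_ _ _ /andP[]]] := st n. Qed.
Let x5_gt0 n : 0 < x5 n. Proof. by have [[_ _ _ _ /andP[]]] := st n. Qed.

Let rate1_gt0 n : 0 < rate1 (x1 n) (x2 n) (x3 n) (x4 n) (x5 n).
Proof. by rewrite divr_gt0 ?(addr_gt0, mulr_gt0). Qed.
Let rate2_gt0 n : 0 < rate2 (x1 n) (x2 n) (x3 n) (x4 n) (x5 n).
Proof. by rewrite divr_gt0 ?(addr_gt0, mulr_gt0). Qed.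
Let rate4_gt0 n : 0 < rate1 (x4 n) (x5 n) (x3 n) (x1 n) (x2 n).
Proof. by rewrite divr_gt0 ?(addr_gt0, mulr_gt0). Qed.
Let rate5_gt0 n : 0 < rate2 (x4 n) (x5 n) (x3 n) (x1 n) (x2 n).
Proof. by rewrite divr_gt0 ?(addr_gt0, mulr_gt0). Qed.

Lemma x1_lower : \forall n \near \oo, 1 / 20 <= x1 n.
Proof.
have [_ [d1 _ _ _ _]] := fl.
apply: (ln_driven_lower (C := 1) (b := 1 / 10) (delta := 1 / 10) x1_gt0 d1); try by lra.
  by apply: nearW => n; have := rate1_gt0 n; lra.
by apply: nearW => n x1n; have := rate1_small (st n) x1n; lra.
Qed.

Lemma x2_lower : \forall n \near \oo, 1 / 200 <= x2 n.
Proof.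
have [_ [_ d2 _ _ _]] := fl.
apply: (ln_driven_lower (C := 1) (b := 1 / 100) (delta := 1 / 200) x2_gt0 d2); try by lra.
  by apply: nearW => n; have := rate2_gt0 n; lra.
apply: filterS x1_lower => n x1n x2n.
by have := rate2_small (st n) x1n x2n; lra.
Qed.

Let alpha n := x1 n / (x1 n + x4 n).

Let s_gt0 n : 0 < x1 n + x4 n. Proof. by rewrite addr_gt0. Qed.

(** The logarithm of [x2 / x5] is driven by the difference in [rate2_diff], and [x2 >= 1 / 2 + m] is
    a level of that ratio. Beyond it [alpha - x2 <= a - m], and the denominator is at most 5. *)
Lemma x2_follows a a' : 0 <= a -> a < a' -> a' < 1 / 2 ->
  (\forall n \near \oo, alpha n - 1 / 2 <= a) ->
  \forall n \near \oo, x2 n - 1 / 2 <= a'.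
Proof.
move=> a0 aa' a'2 ha.
have [_ [_ d2 _ _ d5]] := fl.
pose m := (a + a') / 2.
have [am ma'] : a < m /\ m < a' by rewrite /m; split; lra.
have x25 n : x2 n + x5 n = 1 by have [_ []] := st n.
have d : driven (fun n => ln (x2 n / x5 n)) (fun n =>
    rate2 (x1 n) (x2 n) (x3 n) (x4 n) (x5 n) - rate2 (x4 n) (x5 n) (x3 n) (x1 n) (x2 n)).
  have := driven_sub d2 d5.
  rewrite (_ : (fun n => ln (x2 n) - _) = (fun n => ln (x2 n / x5 n))); last first.
    by apply/funext => n; rewrite ln_div ?posrE.
  rewrite (_ : (fun n => _ - 1 - _) = (fun n => rate2 (x1 n) (x2 n) (x3 n) (x4 n) (x5 n)
      - rate2 (x4 n) (x5 n) (x3 n) (x1 n) (x2 n))) //.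
  by apply/funext => n; ring.
have u0 n : 0 < x2 n / x5 n by rewrite divr_gt0.
have b0 : 0 < (1 / 2 + m) / (1 / 2 - m) by rewrite divr_gt0; lra.
have dl0 : 0 < (m - a) / 5 by rewrite divr_gt0 // subr_gt0.
have bb' : (1 / 2 + m) / (1 / 2 - m) < (1 / 2 + a') / (1 / 2 - a').
  rewrite ltr_pdivrMr; last by lra.
  rewrite mulrAC ltr_pdivlMr; last by lra.
  lra.
have := ln_driven_upper (C := 200) (b := (1 / 2 + m) / (1 / 2 - m))
  (delta := (m - a) / 5) (b' := (1 / 2 + a') / (1 / 2 - a')) u0 d _ b0 dl0 _ bb'.
move=> H; have {}H : \forall n \near \oo, x2 n / x5 n <= (1 / 2 + a') / (1 / 2 - a').
  apply: H.
    apply: filterS x2_lower => n x2n.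
    have := rate2_le (st n); have := rate5_gt0 n.
    suff : (x2 n)^-1 <= 200 by lra.
    by rewrite invf_ple ?posrE //; lra.
  apply: filterS ha => n han.
  rewrite ler_pdivrMr; last by lra.
  rewrite mulrAC ler_pdivlMr // => hx.
  have x2m : 1 / 2 + m <= x2 n by have := x25 n; move: hx; nra.
  rewrite (rate2_diff (st n)); set den := (X in _ / X).
  have den0 : 0 < den by rewrite /den ?(addr_gt0, mulr_gt0).
  have den5 : den <= 5.
    have [[/andP[p1 q1] /andP[p2 q2] /andP[p3 q3] /andP[p4 q4] /andP[p5 q5]] _] := st n.
    have : (x1 n + x4 n) * x2 n * x5 n <= 2 * 1 * 1.
      by rewrite !ler_pM ?mulr_ge0 ?(ltW (s_gt0 n)) ?(ltW p2) ?(ltW p5) //; lra.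
    have : x3 n * (x1 n + x4 n) <= 1 * 2.
      by rewrite ler_pM ?(ltW (s_gt0 n)) ?(ltW p3) //; lra.
    have : x1 n * x4 n <= 1 * 1 by rewrite ler_pM ?(ltW p1) ?(ltW p4).
    by rewrite /den; lra.
  rewrite ler_pdivrMr //.
  have s1 : 1 <= x1 n + x4 n by have [_ []] := st n.
  have xa : x1 n = (x1 n + x4 n) * alpha n.
    by rewrite /alpha mulrC divfK // lt0r_neq0.
  have h1 : (x1 n + x4 n) * (x2 n - alpha n) >= 1 * (m - a).
    by rewrite ler_pM //; lra.
  have h2 : (m - a) / 5 * den <= (m - a) / 5 * 5 by rewrite ler_wpM2l // ltW.
  by move: h1; rewrite mul1r mulrBr -xa; lra.
apply: filterS H => n; rewrite ler_pdivrMr // mulrAC ler_pdivlMr; last by lra.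
by have := x25 n; nra.
Qed.

(* The factors [41/40] and [83/84] are chosen within the slack [21/20] that
   [rate_gap] leaves between the two deviations. *)
Lemma alpha_contracts a : 0 < a ->
  (\forall n \near \oo, `|x2 n - 1 / 2| <= 41 / 40 * a) -> a <= 19 / 40 ->
  (\forall n \near \oo, 1 / 20 <= x4 n) ->
  \forall n \near \oo, alpha n - 1 / 2 <= 83 / 84 * a.
Proof.
move=> a0 h2 a1 h4.
have [_ [d1 _ _ d4 _]] := fl.
(* [21 / 20 * t = 41 / 40 * a], so [rate_gap] applies as soon as [alpha - 1 / 2 >= t]; [t'] is the
   midpoint of [t] and [a]. *)
pose t := 41 / 42 * a; pose t' := 83 / 84 * a.
have [t0 tt' t'2] : [/\ 0 < t, t < t' & t' < 1 / 2] by rewrite /t /t'; split; lra.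
have d : driven (fun n => ln (x1 n / x4 n)) (fun n =>
    rate1 (x1 n) (x2 n) (x3 n) (x4 n) (x5 n) - rate1 (x4 n) (x5 n) (x3 n) (x1 n) (x2 n)).
  have := driven_sub d1 d4.
  rewrite (_ : (fun n => ln (x1 n) - _) = (fun n => ln (x1 n / x4 n))); last first.
    by apply/funext => n; rewrite ln_div ?posrE.
  rewrite (_ : (fun n => _ - 1 - _) = (fun n => rate1 (x1 n) (x2 n) (x3 n) (x4 n) (x5 n)
      - rate1 (x4 n) (x5 n) (x3 n) (x1 n) (x2 n))) //.
  by apply/funext => n; ring.
have u0 n : 0 < x1 n / x4 n by rewrite divr_gt0.
have b0 : 0 < (1 / 2 + t) / (1 / 2 - t) by rewrite divr_gt0; lra.
have dl0 : 0 < t / 20 ^+ 6 by rewrite divr_gt0 ?exprn_gt0.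
have bb' : (1 / 2 + t) / (1 / 2 - t) < (1 / 2 + t') / (1 / 2 - t').
  rewrite ltr_pdivrMr; last by lra.
  rewrite mulrAC ltr_pdivlMr; last by lra.
  lra.
have := ln_driven_upper (C := 20) (b := (1 / 2 + t) / (1 / 2 - t))
  (delta := t / 20 ^+ 6) (b' := (1 / 2 + t') / (1 / 2 - t')) u0 d _ b0 dl0 _ bb'.
move=> H; have {}H : \forall n \near \oo, x1 n / x4 n <= (1 / 2 + t') / (1 / 2 - t').
  apply: H.
    apply: filterS x1_lower => n x1n.
    have := rate1_le (st n); have := rate4_gt0 n.
    suff : (x1 n)^-1 <= 20 by lra.
    by rewrite invf_ple ?posrE //; lra.
  apply: filterS (filterI h2 (filterI h4 x1_lower)) => n [h2n [h4n h1n]].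
  rewrite ler_pdivrMr; last by lra.
  rewrite mulrAC ler_pdivlMr // => hx.
  have ta : t <= alpha n - 1 / 2.
    by rewrite lerBrDr /alpha ler_pdivlMr //; move: hx; lra.
  apply: (rate_gap (st n)) => //; apply: le_trans h2n _.
  by rewrite -/(alpha n); move: ta; rewrite /t; lra.
apply: filterS H => n; rewrite ler_pdivrMr // mulrAC ler_pdivlMr; last by lra.
rewrite lerBlDr /alpha ler_pdivrMr // -/t'; lra.
Qed.

End OneFlow.

Section TwoSided.
Context (x1 x2 x3 x4 x5 : R^nat).
Hypothesis fl : flow x1 x2 x3 x4 x5.
Let fl' := flow_swap fl.

Let alpha n := x1 n / (x1 n + x4 n).

Let st n : lozenge_state (x1 n) (x2 n) (x3 n) (x4 n) (x5 n).
Proof. by case: fl. Qed.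

Let x1_gt0 n : 0 < x1 n. Proof. by have [[/andP[]]] := st n. Qed.
Let x3_gt0 n : 0 < x3 n. Proof. by have [[_ _ /andP[]]] := st n. Qed.
Let x4_gt0 n : 0 < x4 n. Proof. by have [[_ _ _ /andP[]]] := st n. Qed.
Let s_gt0 n : 0 < x1 n + x4 n. Proof. by rewrite addr_gt0. Qed.

Let alpha_swap n : x4 n / (x4 n + x1 n) - 1 / 2 = - (alpha n - 1 / 2).
Proof. by rewrite /alpha [x4 n + x1 n]addrC; field; rewrite lt0r_neq0. Qed.

Let x5_swap n : x5 n - 1 / 2 = - (x2 n - 1 / 2).
Proof. by have [_ []] := st n; lra. Qed.

Lemma x2_follows_norm a a' : 0 <= a -> a < a' -> a' < 1 / 2 ->
  (\forall n \near \oo, `|alpha n - 1 / 2| <= a) ->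
  \forall n \near \oo, `|x2 n - 1 / 2| <= a'.
Proof.
move=> a0 aa' a'2 ha.
have up : \forall n \near \oo, x2 n - 1 / 2 <= a'.
  apply: (x2_follows fl a0 aa' a'2); apply: filterS ha => n.
  by rewrite ler_norml => /andP[].
have lo : \forall n \near \oo, x5 n - 1 / 2 <= a'.
  apply: (x2_follows fl' a0 aa' a'2); apply: filterS ha => n.
  by rewrite alpha_swap lerNl ler_norml => /andP[].
apply: filterS2 up lo => n hu; rewrite x5_swap lerNl => hl.
by rewrite ler_norml hl hu.
Qed.

Lemma alpha_contracts_norm a : 0 < a -> a <= 19 / 40 ->
  (\forall n \near \oo, `|alpha n - 1 / 2| <= a) ->
  \forall n \near \oo, `|alpha n - 1 / 2| <= 83 / 84 * a.
Proof.
move=> a0 a1 ha.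
(* The new level is still below 1/2, since [41 / 40 * (19 / 40) < 1 / 2]. *)
have h2 : \forall n \near \oo, `|x2 n - 1 / 2| <= 41 / 40 * a.
  by apply: (x2_follows_norm (a := a)) => //; lra.
have h5 : \forall n \near \oo, `|x5 n - 1 / 2| <= 41 / 40 * a.
  by apply: filterS h2 => n; rewrite x5_swap normrN.
have up := alpha_contracts fl a0 h2 a1 (x1_lower fl').
have lo := alpha_contracts fl' a0 h5 a1 (x1_lower fl).
apply: filterS2 up lo => n hu; rewrite alpha_swap lerNl => hl.
by rewrite ler_norml hl hu.
Qed.

(** Each contraction holds only eventually, but finitely many of them reach [eta]. The initial level
    19/40 comes from [x1] and [x4] lying between 1/20 and 1. *)
Lemma alpha_near eta : 0 < eta -> \forall n \near \oo, `|alpha n - 1 / 2| <= eta.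
Proof.
move=> eta0.
have q0 k : 0 < (83 / 84) ^+ k :> R by rewrite exprn_gt0.
have q1 k : (83 / 84) ^+ k <= 1 :> R by rewrite exprn_ile1 //; lra.
have iter k : \forall n \near \oo, `|alpha n - 1 / 2| <= (83 / 84) ^+ k * (19 / 40).
  elim: k => [|k IH].
    rewrite expr0 mul1r; apply: filterS2 (x1_lower fl) (x1_lower fl') => n h1 h4.
    have [[/andP[_ q] _ _ /andP[_ q']  _] _] := st n.
    rewrite ler_norml lerBrDr lerBlDr /alpha ler_pdivlMr // ler_pdivrMr //.
    by apply/andP; split; lra.
  rewrite exprS -mulrA; apply: alpha_contracts_norm => //.
  by rewrite -[leRHS]mul1r ler_wpM2r //; lra.
have /cvgrPdist_lt /(_ _ eta0) : (fun k => (83 / 84) ^+ k : R) @ \oo --> 0.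
  by apply: cvg_expr; rewrite ger0_norm //; lra.
case=> k _ /(_ k (leqnn k)); rewrite /= sub0r normrN ger0_norm ?(ltW (q0 k)) // => hk.
apply: filterS (iter k) => n hn; apply: le_trans hn _.
by apply: le_trans (ltW hk); rewrite ler_piMr ?(ltW (q0 k)) //; lra.
Qed.

Lemma x2_near eta : 0 < eta -> \forall n \near \oo, `|x2 n - 1 / 2| <= eta.
Proof.
move=> eta0; pose e := Num.min eta (1 / 4).
have e0 : 0 < e by rewrite lt_min eta0 /=; lra.
have ee : e <= eta by rewrite ge_min lexx.
have e4 : e <= 1 / 4 by rewrite ge_min lexx orbT.
have := @x2_follows_norm (e / 2) e.
move=> H; have {}H : \forall n \near \oo, `|x2 n - 1 / 2| <= e.
  by apply: H; [lra|lra|lra|apply: alpha_near; lra].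
by apply: filterS H => n hn; exact: le_trans hn ee.
Qed.

Lemma x14_near eta : 0 < eta -> \forall n \near \oo, `|x4 n - x1 n| <= eta.
Proof.
move=> eta0; have eta4 : 0 < eta / 4 by rewrite divr_gt0.
apply: filterS (alpha_near eta4) => n hn.
have [[/andP[_ q] _ _ /andP[_ q']  _] _] := st n.
have -> : x4 n - x1 n = - (2 * (x1 n + x4 n) * (alpha n - 1 / 2)).
  by rewrite /alpha; field; rewrite lt0r_neq0.
rewrite normrN normrM ger0_norm ?mulr_ge0 ?(ltW (s_gt0 n)) //.
have : 2 * (x1 n + x4 n) * `|alpha n - 1 / 2| <= 4 * (eta / 4).
  by rewrite ler_pM ?mulr_ge0 ?(ltW (s_gt0 n)) //; lra.
by lra.
Qed.

(** With [x2] and [x5] within [e / 4] of 1/2, the drift lies between two functions of [x3] that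
    vanish within [e / 4] of 1/2; at distance [e / 2] a drift of size [e / 8] remains. *)
Lemma x3_near eta : 0 < eta -> \forall n \near \oo, `|x3 n - 1 / 2| <= eta.
Proof.
move=> eta0; pose e := Num.min eta (1 / 4).
have e0 : 0 < e by rewrite lt_min eta0 /=; lra.
have ee : e <= eta by rewrite ge_min lexx.
have e4 : e <= 1 / 4 by rewrite ge_min lexx orbT.
have [_ [_ _ d3 _ _]] := fl.
have bnd : \forall n \near \oo,
    (x3 n + (1 / 2 + e / 4))^-1 <= rate3 (x1 n) (x2 n) (x3 n) (x4 n) (x5 n)
      <= (x3 n + (1 / 2 - e / 4))^-1.
  have e40 : 0 < e / 4 by rewrite divr_gt0.
  apply: filterS (x2_near e40) => n; rewrite ler_norml => /andP[lo hi].
  have := x5_swap n => h5.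
  by apply: (rate3_bounds (st n)); [lra|apply/andP; split; lra|apply/andP; split; lra].
have up : \forall n \near \oo, x3 n <= 1 / 2 + e.
  apply: (ln_driven_upper (C := 4) (b := 1 / 2 + e / 2) (delta := e / 8) x3_gt0 d3); try by lra.
  - apply: filterS bnd => n /andP[_ hn]; have x3n := x3_gt0 n.
    suff : (x3 n + (1 / 2 - e / 4))^-1 <= 4 by lra.
    by rewrite invf_ple ?posrE; lra.
  - apply: filterS bnd => n /andP[_ hn] xn.
    suff : (x3 n + (1 / 2 - e / 4))^-1 <= 1 - e / 8 by lra.
    rewrite invf_ple ?posrE; [|lra|lra]; rewrite -div1r ler_pdivrMr; last by lra.
    have : (1 + e / 4) * (1 - e / 8) <= (x3 n + (1 / 2 - e / 4)) * (1 - e / 8).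
      by rewrite ler_wpM2r; lra.
    have : e * e <= e * (1 / 4) by rewrite ler_wpM2l // ltW.
    by lra.
have lo : \forall n \near \oo, 1 / 2 - e <= x3 n.
  apply: (ln_driven_lower (C := 1) (b := 1 / 2 - e / 2) (delta := e / 8) x3_gt0 d3); try by lra.
  - apply: filterS bnd => n /andP[hn _]; have x3n := x3_gt0 n.
    have : 0 < (x3 n + (1 / 2 + e / 4))^-1 by rewrite invr_gt0; lra.
    by lra.
  - apply: filterS bnd => n /andP[hn _] xn; have x3n := x3_gt0 n.
    suff : 1 + e / 8 <= (x3 n + (1 / 2 + e / 4))^-1 by lra.
    rewrite -[leRHS]div1r ler_pdivlMr; last by lra.
    have : (1 + e / 8) * (x3 n + (1 / 2 + e / 4)) <= (1 + e / 8) * (1 - e / 4).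
      by rewrite ler_wpM2l; lra.
    have : 0 <= e * e by rewrite mulr_ge0 // ltW.
    by lra.
by apply: filterS2 up lo => n hu hl; rewrite ler_norml; apply/andP; split; lra.
Qed.

Lemma x1_near w eta : 0 < w -> limit_cubic w = 0 -> 0 < eta ->
  \forall n \near \oo, `|x1 n - w| <= eta.
Proof.
(* The bound [w / 4] keeps the lower level [w - 2 * e] positive, as its logarithm requires. *)
move=> w0 Gw eta0; pose e := Num.min (eta / 2) (w / 4).
have e0 : 0 < e by rewrite lt_min !divr_gt0.
have ee : e <= eta / 2 by rewrite ge_min lexx.
have ew : e <= w / 4 by rewrite ge_min lexx orbT.
have e100 : 0 < e / 100 by rewrite divr_gt0.
have e40 : 0 < e / 40 by rewrite divr_gt0.
have [_ [d1 _ _ _ _]] := fl.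
have up : \forall n \near \oo, x1 n <= w + eta.
  apply: (ln_driven_upper (C := 20) (b := w + e) (delta := e / 40) x1_gt0 d1); try by lra.
  - apply: filterS (x1_lower fl) => n x1n.
    have := rate1_le (st n).
    suff : (x1 n)^-1 <= 20 by lra.
    by rewrite invf_ple ?posrE //; lra.
  - apply: filterS (filterI (x2_near e100) (filterI (x3_near e100) (x14_near e100)))
      => n [h2 [h3 h4]] hn.
    exact: rate1_above (st n) w0 Gw e0 hn h2 h3 h4.
have lo : \forall n \near \oo, w - 2 * e <= x1 n.
  apply: (ln_driven_lower (C := 1) (b := w - e) (delta := e / 40) x1_gt0 d1); try by lra.
  - apply: filterS (x1_lower fl) => n x1n.
    suff : 0 < rate1 (x1 n) (x2 n) (x3 n) (x4 n) (x5 n) by lra.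
    have [[/andP[p1 _] /andP[p2 _] /andP[p3 _] /andP[p4 _] /andP[p5 _]] _] := st n.
    by rewrite divr_gt0 ?(addr_gt0, mulr_gt0).
  - apply: filterS (filterI (x2_near e100) (filterI (x3_near e100) (x14_near e100)))
      => n [h2 [h3 h4]] hn.
    exact: rate1_below (st n) w0 Gw e0 hn h2 h3 h4.
by apply: filterS2 up lo => n hu hl; rewrite ler_norml; apply/andP; split; lra.
Qed.

End TwoSided.
End Flow.

(** * Transfer to the weight process and conclusion *)

Lemma rate_scale (R : realType) (w : edge lozenge -> R) (l : R) e :
  (forall e, 0 < w e) -> 0 < l -> rate (fun e => w e / l) e = l * rate w e.
Proof.
move=> w0 l0.
have [[[[v1 v2] v3] v4] v5] := (w0 edge1, w0 edge2, w0 edge3, w0 edge4, w0 edge5).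
case: e => [[|[|[|[|[|//]]]]] i]; rewrite /rate /= /rate1 /rate2 /rate3;
  by field; pos_neq0.
Qed.

Lemma cvg_row (R : realType) m (M : nat -> 'rV[R]_m) (L : 'rV[R]_m) :
  (forall j, (fun n => M n 0 j) @ \oo --> L 0 j) -> M @ \oo --> L.
Proof.
move=> ML; apply/cvg_mx_entourageP => A entA.
have Hj j : \forall n \near \oo, (L 0 j, M n 0 j) \in A.
  have LA : \forall n \near \oo, A (L 0 j, M n 0 j).
    exact: (cvg_entourageP _ _).1 (ML j) A entA.
  by apply: filterS LA => n An; apply/mem_set.
have H : \forall n \near \oo, forall j, (L 0 j, M n 0 j) \in A.
  by apply: filter_forall => j; exact: Hj.
suff : \forall n \near \oo, forall i j, (L i j, M n i j) \in A by [].
by apply: filterS H => n Hn i j; rewrite (ord1 i).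
Qed.

Lemma limit_cubic_has_root (R : realType) :
  exists2 w : R, 0 < w < 1 & limit_cubic w = 0.
Proof.
pose p : {poly R} := 2 *: 'X^3 + 4 *: 'X^2 - 2 *: 'X - (3 / 2)%:P.
have pE x : p.[x] = limit_cubic x by rewrite /p /limit_cubic !hornerE.
have [|w /andP[w0 w1] /rootP] := @poly_ivt R p 0 1 ler01.
  by rewrite !pE /limit_cubic; apply/andP; split; lra.
rewrite pE => Gw; exists w => //; apply/andP; split.
  rewrite lt_neqAle w0 andbT; apply/eqP => w00.
  by move: Gw; rewrite -w00 /limit_cubic; lra.
rewrite lt_neqAle w1 andbT; apply/eqP => w11.
by move: Gw; rewrite w11 /limit_cubic; lra.
Qed.

Section TrajectoryLimit.
Context (R : realType) (T : Type).
Context (walk : nat -> nat -> T -> option (edge lozenge)) (t : T).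

Let W n e : R := (weight walk n t e)%:R.
(** Edges 2 and 5 start with total weight 2, so dividing by [n + 2] makes [x2 + x5 = 1] exact. *)
Let x e n : R := W n e / n.+2%:R.

Hypothesis mart : forall e, cvgn (fun n =>
  \sum_(k < n) ((e \in trace walk k t)%:R / W k e - rate (W k) e)).
Hypothesis h25 : forall n, (edge2 \in trace walk n t) = ~~ (edge5 \in trace walk n t).
Hypothesis h14 : forall n, (edge1 \in trace walk n t) || (edge4 \in trace walk n t).

Let weightS n e : weight walk n.+1 t e = (weight walk n t e + (e \in trace walk n t))%N.
Proof. by rewrite /= ffunE. Qed.

Let weight_gt0 n e : (0 < weight walk n t e)%N.
Proof. by elim: n => [|n IH]; rewrite ?weightS /= ?ffunE // addn_gt0 IH. Qed.

Let W_gt0 n e : 0 < W n e. Proof. by rewrite ltr0n. Qed.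

Let x_gt0 n e : 0 < x e n. Proof. by rewrite divr_gt0. Qed.

Let weight_le n e : (weight walk n t e <= n.+1)%N.
Proof.
elim: n => [|n IH]; first by rewrite /= ffunE.
by rewrite weightS -addn1 leq_add // leq_b1.
Qed.

Let weight25 n : (weight walk n t edge2 + weight walk n t edge5 = n.+2)%N.
Proof.
elim: n => [|n IH]; first by rewrite /= !ffunE.
by rewrite !weightS addnACA IH h25; case: (edge5 \in _); rewrite ?addn0 ?addn1.
Qed.

Let weight14 n : (n.+2 <= weight walk n t edge1 + weight walk n t edge4)%N.
Proof.
elim: n => [|n IH]; first by rewrite /= !ffunE.
rewrite !weightS addnACA -addn1 leq_add //.
by case: (edge1 \in _) (edge4 \in _) (h14 n) => [] [].
Qed.

(** [n + 2] is itself a counter, moving at every step; its logarithm contributes the [- 1] of the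
    drift. *)
Let x_driven e : driven (fun n => ln (x e n)) (fun n => rate (x ^~ n) e - 1).
Proof.
have c1 := @ln_counter_cvg R (fun n => weight walk n t e)
  (fun n => e \in trace walk n t) (weight_gt0 0 e) (fun n => weightS n e).
have c2 := @ln_counter_cvg R (fun n => n.+2) (fun=> true) isT
  (fun n => esym (addn1 n.+2)).
rewrite /driven (_ : (fun n => _) = (fun n =>
    (ln (W n e) - \sum_(k < n) (e \in trace walk k t)%:R / W k e) +
    \sum_(k < n) ((e \in trace walk k t)%:R / W k e - rate (W k) e) -
    (ln n.+2%:R - \sum_(k < n) true%:R / k.+2%:R))).
  exact: is_cvgB (is_cvgD c1 (@mart e)) c2.
apply/funext => n.
have pos k : k.+2%:R != 0 :> R by rewrite pnatr_eq0.
rewrite (eq_bigr (fun k : 'I_n => rate (W k) e - true%:R / k.+2%:R)); last first.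
  (* The rates are homogeneous of degree -1, so the rate at the normalized weights, divided by
     [k + 2], is the rate at the weights. *)
  by move=> k _; rewrite /x rate_scale // mulrBl mulrAC divff ?pos // !mul1r.
rewrite [x e n]/x ln_div ?posrE // !sumrB.
ring.
Qed.

Let x_state n : lozenge_state (x edge1 n) (x edge2 n) (x edge3 n) (x edge4 n) (x edge5 n).
Proof.
have x01 e : 0 < x e n <= 1.
  rewrite x_gt0 /= /x ler_pdivrMr ?ltr0n // mul1r ler_nat.
  by rewrite (leq_trans (weight_le n e)).
split; first by split.
rewrite /x -!mulrDl -!natrD weight25 divff ?pnatr_eq0 //; split => //.
by rewrite ler_pdivlMr ?ltr0n // mul1r ler_nat.
Qed.

Let x_flow : flow (x edge1) (x edge2) (x edge3) (x edge4) (x edge5).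
Proof. by split; [exact: x_state|split; exact: x_driven]. Qed.

Lemma pathwise_limit (w : R) : 0 < w -> limit_cubic w = 0 ->
  (fun n : nat => n%:R^-1 *: \row_(i < 5) (weight walk n t i)%:R)
    @ \oo --> \row_(i < 5) [:: w; 1 / 2; 1 / 2; w; 1 / 2]`_i.
Proof.
move=> w0 Gw.
have near_cvg (u : R^nat) (l : R) :
    (forall eta, 0 < eta -> \forall n \near \oo, `|u n - l| <= eta) -> u @ \oo --> l.
  move=> H; apply/cvgrPdist_le => eta /H; apply: filterS => n.
  by rewrite distrC.
have x_cvg (i : 'I_5) : x i @ \oo --> [:: w; 1 / 2; 1 / 2; w; 1 / 2]`_i.
  apply: near_cvg => eta eta0.
  case: i => [[|[|[|[|[|//]]]]] i] /=.
  - by rewrite (_ : Ordinal i = edge1); [exact: (x1_near x_flow)|exact: val_inj].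
  - by rewrite (_ : Ordinal i = edge2); [exact: (x2_near x_flow)|exact: val_inj].
  - by rewrite (_ : Ordinal i = edge3); [exact: (x3_near x_flow)|exact: val_inj].
  - by rewrite (_ : Ordinal i = edge4); [exact: (x1_near (flow_swap x_flow))|exact: val_inj].
  - by rewrite (_ : Ordinal i = edge5); [exact: (x2_near (flow_swap x_flow))|exact: val_inj].
apply: cvg_row => j; rewrite mxE.
(* Correction from the normalization by [n + 2] to the one by [n]. *)
have ratio : (fun n : nat => 1 + 2 / n%:R : R) @ \oo --> (1 + 2 * 0 : R).
  apply: cvgD; first exact: cvg_cst.
  apply: cvgMr; apply/cvgrPdist_le => eta eta0.
  near=> n; rewrite sub0r normrN ger0_norm ?invr_ge0 //.
  have n0 : 0 < n%:R :> R by near: n; exact: nbhs_infty_gtr.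
  rewrite invf_ple ?posrE //; near: n; exact: nbhs_infty_ger.
have c := cvgM (x_cvg j) ratio; rewrite mulr0 addr0 mulr1 in c.
apply: (cvg_trans _ (c _)); apply: near_eq_cvg; near=> n; rewrite /= !mxE /x /W.
have n0 : 0 < n%:R :> R by near: n; exact: nbhs_infty_gtr.
have n2 : 0 < 2 + n%:R :> R by rewrite addr_gt0.
by rewrite -addn2 natrD; field; rewrite ?lt0r_neq0 // addrC.
Unshelve. all: by end_near. Qed.

End TrajectoryLimit.

Theorem proposition1p6 (d : measure_display) (T : measurableType d)
    (R : realType) (P : probability T R)
    (walk : nat -> nat -> T -> option (edge lozenge))
    (hwalk : trace_reinforced_ants P walk) :
  exists wstar : R,
    unique (fun x : R => 0 < x < 1 /\
      2 * x ^+ 3 + 4 * x ^+ 2 - 2 * x - 3 / 2 = 0) wstar /\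
    {ae P, forall t : T,
      (fun n : nat => n%:R^-1 *: \row_(i < 5) (weight walk n t i)%:R)
        @ \oo --> \row_(i < 5) [:: wstar; 1 / 2; 1 / 2; wstar; 1 / 2]`_i}.
Proof.
have [w w01 Gw] := limit_cubic_has_root R; have /andP[w0 _] := w01.
exists w; split.
  split => // y [/andP[y0 _] Gy].
  (* The cofactor is at least 3/2, so it cannot vanish at a second root. *)
  have [c c1 Gyc] := limit_cubic_root w0 Gw y0.
  have /eqP : (y - w) * c = 0 by rewrite -Gyc.
  rewrite mulf_eq0 => /orP[|/eqP c0]; first by rewrite subr_eq0 => /eqP.
  by move: c1; rewrite c0; lra.
have mart := ae_forall_count (fun e : edge lozenge => trace_martingale_cvg hwalk e).
apply: filterS (filterI mart (filterI (trace25 hwalk) (trace14 hwalk))).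
by move=> t [ht [h25 h14]]; exact: pathwise_limit.
Qed.
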